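(* Let $\mu$ be the self-affine measure on a Lalley-Gatzouras carpet associated with the maps $(f_{ij})_{(i,j)\in G}$ and a positive probability vector $(p_{ij})_{(i,j)\in G}$. For every $q\in[0,\infty)$, the $L^q$-spectrum $T(q)=T_\mu(q)$ of $\mu$ is the unique solution of the equation $$\lim_{l\to\infty}\frac1l\log\sum_{\sigma\in\Psi_l}(p_{\sigma_L}q_{\sigma_R})^q\,a_{\sigma_L}^{T(q)}=0.$$
   Context: Setting. Let $m\ge1$ be an integer and let $n_j\ge1$ ($1\le j\le m$) be integers. Let $b_j,d_j$ ($1\le j\le m$) be positive numbers with $\sum_{j=1}^m b_j\le1$, $d_m\le1-b_m$, and (if $m\ge2$) $b_j+d_j\le d_{j+1}$ for $1\le j\le m-1$. Put $G=\{(i,j):1\le i\le n_j,\,1\le j\le m\}$ and $G_y=\{1,\ldots,m\}$. For $(i,j)\in G$ let $a_{ij}>0$ and $c_{ij}\ge0$ be such that for each $j$: $\sum_{i=1}^{n_j}a_{ij}\le1$, $\max_{1\le i\le n_j}a_{ij}<b_j$, $a_{n_jj}\le1-c_{n_jj}$, and $a_{ij}+c_{ij}\le c_{(i+1)j}$ for $1\le i\le n_j-1$. Let $f_{ij}(x,y)=(a_{ij}x+c_{ij},\,b_jy+d_j)$ on $\mathbb{R}^2$. The Lalley-Gatzouras carpet $E$ is the unique non-empty compact set with $E=\bigcup_{(i,j)\in G}f_{ij}(E)$. Given a probability vector $(p_{ij})_{(i,j)\in G}$ with all $p_{ij}>0$, $\mu$ is the unique Borel probability measure with $\mu=\sum_{(i,j)\in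 G}p_{ij}\,\mu\circ f_{ij}^{-1}$. Put $q_j=\sum_{i=1}^{n_j}p_{ij}$. Words. $G_y^*=\bigcup_{k\ge1}G_y^k$. For $\omega=((i_1,j_1),\ldots,(i_l,j_l))\in G^l$ and $\tau=(j_{l+1},\ldots,j_k)\in G_y^{k-l}$ ($k>l$) write $\sigma=\omega\ast\tau=((i_1,j_1),\ldots,(i_l,j_l),j_{l+1},\ldots,j_k)$, $\sigma_L=\omega$, $\sigma_R=\tau$, $\sigma_y=(j_1,\ldots,j_k)$, $\sigma_y^-=(j_1,\ldots,j_{k-1})$. Put $a_{\sigma_L}=\prod_{h=1}^la_{i_hj_h}$, $p_{\sigma_L}=\prod_{h=1}^lp_{i_hj_h}$, $q_{\sigma_R}=\prod_{h=l+1}^kq_{j_h}$, and $b_{\rho}=\prod_h b_{\rho_h}$ for a word $\rho=(\rho_1,\rho_2,\ldots)$ over $G_y$. For $l\ge1$, $$\Psi_l=\{\sigma=\sigma_L\ast\sigma_R:\ \sigma_L\in G^l,\ \sigma_R\in G_y^*,\ b_{\sigma_y^-}\ge a_{\sigma_L}>b_{\sigma_y}\}.$$ $L^q$-spectrum. For $n\ge1$ let $\mathcal{C}_n$ be the partition of $\mathbb{R}^2$ into the squares $\prod_{h=1}^2[k_h2^{-n},(k_h+1)2^{-n})$, $(k_1,k_2)\in\mathbb{Z}^2$. For a Borel measure $\nu$ with topological support $K_\nu$ let $\mathcal{C}_n^\flat(\nu)=\{C\in\mathcal{C}_n:C\cap K_\nu\ne\emptyset\}$. For $q\ge0$, $$T_\nu(q)=\lim_{n\to\infty}\frac{\log\sum_{C\in\mathcal{C}_n^\flat(\nu)}\nu(C)^q}{n\log2}$$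 if the limit exists. *)

(* Defs.v *)
From HB Require Import structures.
From mathcomp Require Import all_boot all_order all_algebra.
From mathcomp Require Import all_classical all_reals all_analysis.

Set Implicit Arguments.
Unset Strict Implicit.
Unset Printing Implicit Defensive.

Import Order.TTheory GRing.Theory Num.Theory.
Import numFieldNormedType.Exports.

Local Open Scope classical_set_scope.
Local Open Scope ring_scope.

(* Indices start at 0 instead of 1, and the pair (i, j) of a column index i
   and a row index j is encoded with the row first, as [Tagged _ i], because
   the range of i depends on j. *)
Record LG_system (R : realType) := LGSystem {
  lg_m : nat;
  lg_n : 'I_lg_m -> nat;
  lg_a : forall j : 'I_lg_m, 'I_(lg_n j) -> R;
  lg_c : forall j : 'I_lg_m, 'I_(lg_n j) -> R;
  lg_b : 'I_lg_m -> R;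
  lg_d : 'I_lg_m -> R;
  lg_m_ge1 : (1 <= lg_m)%N;
  lg_n_ge1 : forall j, (1 <= lg_n j)%N;
  lg_b_gt0 : forall j, 0 < lg_b j;
  lg_d_gt0 : forall j, 0 < lg_d j;
  lg_b_sum : \sum_(j < lg_m) lg_b j <= 1;
  lg_d_last : forall j : 'I_lg_m, j.+1 = lg_m -> lg_d j <= 1 - lg_b j;
  lg_d_step : forall j k : 'I_lg_m, k = j.+1 :> nat ->
    lg_b j + lg_d j <= lg_d k;
  lg_a_gt0 : forall j (i : 'I_(lg_n j)), 0 < lg_a i;
  lg_c_ge0 : forall j (i : 'I_(lg_n j)), 0 <= lg_c i;
  lg_a_sum : forall j, \sum_(i < lg_n j) lg_a i <= 1;
  lg_a_lt_b : forall j (i : 'I_(lg_n j)), lg_a i < lg_b j;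
  lg_c_last : forall j (i : 'I_(lg_n j)), i.+1 = lg_n j ->
    lg_a i <= 1 - lg_c i;
  lg_c_step : forall j (i k : 'I_(lg_n j)), k = i.+1 :> nat ->
    lg_a i + lg_c i <= lg_c k
}.

Section LalleyGatzouras.
Context {R : realType} (S : LG_system R).

Definition LG_index := {j : 'I_(lg_m S) & 'I_(lg_n j)}.

Definition LG_map (g : LG_index) (x : R * R) : R * R :=
  (lg_a (tagged g) * x.1 + lg_c (tagged g),
   lg_b (tag g) * x.2 + lg_d (tag g)).

Definition positive_probability_vector (p : LG_index -> R) :=
  (forall g, 0 < p g) /\ \sum_(g : LG_index) p g = 1.

Definition self_affine (p : LG_index -> R)
    (mu : {measure set (R * R)%type -> \bar R}) :=
  forall A : set (R * R), measurable A ->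
    mu A = (\sum_(g : LG_index) (p g)%:E * pushforward mu (LG_map g) A)%E.

Definition row_prob (p : LG_index -> R) (j : 'I_(lg_m S)) : R :=
  \sum_(i < lg_n j) p (Tagged (fun j => 'I_(lg_n j)) i).

(* The pair (sigma_L, sigma_R) stands for the word sigma_L * sigma_R. *)
Definition mixed_word := (seq LG_index * seq 'I_(lg_m S))%type.

Definition a_word (w : seq LG_index) : R := \prod_(g <- w) lg_a (tagged g).

Definition b_word (w : seq 'I_(lg_m S)) : R := \prod_(j <- w) lg_b j.

Definition p_word (p : LG_index -> R) (w : seq LG_index) : R :=
  \prod_(g <- w) p g.

Definition q_word (p : LG_index -> R) (w : seq 'I_(lg_m S)) : R :=
  \prod_(j <- w) row_prob p j.

Definition y_word (s : mixed_word) : seq 'I_(lg_m S) :=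
  [seq tag g | g <- s.1] ++ s.2.

Definition y_word_init (s : mixed_word) : seq 'I_(lg_m S) :=
  take (size (y_word s)).-1 (y_word s).

Definition Psi (l : nat) : set mixed_word :=
  [set s | [/\ size s.1 = l, (1 <= size s.2)%N,
               a_word s.1 <= b_word (y_word_init s) &
               b_word (y_word s) < a_word s.1]].

(* [Psi l] is finite since every [lg_b j] is smaller than 1, so the finitely
   supported sum below is the actual sum over [Psi l]. *)
Definition Psi_sum (p : LG_index -> R) (q t : R) (l : nat) : R :=
  \sum_(s \in Psi l) (p_word p s.1 * q_word p s.2) `^ q * a_word s.1 `^ t.

Definition Psi_equation (p : LG_index -> R) (q t : R) :=
  (fun l : nat => l%:R^-1 * ln (Psi_sum p q t l)) @ \oo --> (0 : R).

End LalleyGatzouras.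

Section LqSpectrum.
Context {R : realType}.

Definition dyadic_square (n : nat) (k : int * int) : set (R * R) :=
  [set x | k.1%:~R * 2 ^- n <= x.1 < (k.1 + 1)%:~R * 2 ^- n /\
           k.2%:~R * 2 ^- n <= x.2 < (k.2 + 1)%:~R * 2 ^- n].

Definition dyadic_partition (n : nat) : set (set (R * R)) :=
  range (dyadic_square n).

Definition topological_support (nu : {measure set (R * R)%type -> \bar R}) :
    set (R * R) :=
  [set x | forall U : set (R * R), open U -> U x -> (0 < nu U)%E].

Definition dyadic_flat (nu : {measure set (R * R)%type -> \bar R}) (n : nat) :
    set (set (R * R)) :=
  [set C | dyadic_partition n C /\ C `&` topological_support nu !=set0].

(* [poweR 0 0 = 1], so for q = 0 the sum counts the squares. *)
Definition is_Lq_spectrum (nu : {measure set (R * R)%type -> \bar R})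
    (q T : R) :=
  (fun n : nat =>
     (lne (\esum_(C in dyadic_flat nu n) poweR (nu C) q)
        * ((n%:R * ln 2)^-1)%:E)%E) @ \oo --> T%:E.

End LqSpectrum.

(* Main.v *)
Require Import Defs.
From HB Require Import structures.
From mathcomp Require Import all_boot all_order all_algebra.
From mathcomp Require Import all_classical all_reals all_analysis.
From mathcomp Require Import measurable_realfun.
From mathcomp Require Import ring lra zify.
Import Order.TTheory GRing.Theory Num.Theory.
Import numFieldNormedType.Exports.
Local Open Scope classical_set_scope.
Local Open Scope ring_scope.

(* Both quantities have closed forms. Let beta solve
   sum_j q_j^q b_j^beta = 1 and put
   growth t = sum_ij p_ij^q b_j^beta a_ij^(t - beta).
   The weights q_tau^q b_tau^beta are harmonic on the tree of row words, so they
   sum to 1 over every stopping time; since b_(sigma_y) and a_(sigma_L) differ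
   by a bounded factor, the sum over Psi_l is (growth t)^l up to a constant, and
   the equation of the theorem says growth t = 1. For that t the weights
   p_w^q b_w^beta a_w^(t - beta) are harmonic too, and stopping when a_w < r
   shows that the approximate squares of size r satisfy
   sum (p_(sigma_L) q_(sigma_R))^q = r^(-t) up to a constant.
   The measure splits into pieces of mass p_(sigma_L) q_(sigma_R) carried by
   these approximate squares. Each of them meets at most 4 dyadic squares of
   side r = 2^(-n), and a dyadic square meets a bounded number of them: their
   half-open versions are disjoint and contain a point of a grid whose mesh is a
   fixed multiple of r. Hence the dyadic sum has the same order r^(-t). *)

(** * Stopping times on a tree of words *)

Section StoppingTime.
Set Implicit Arguments.
Unset Strict Implicit.
Context {T : finType}.
Implicit Types (stop : pred (seq T)) (w v : seq T).

(** Leaves reached from [w] when each branch is followed until it stops; [n] is fuel, and a branch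
    still running when it is spent is truncated there. *)
Fixpoint cut stop n w : seq (seq T) :=
  if n is n'.+1 then
    if stop w then [:: w]
    else flatten [seq cut stop n' (rcons w x) | x <- enum T]
  else [:: w].

(** Replacing a vertex by its children does not change the sum of a harmonic [F], and truncated
    branches obey the same rule. *)
Lemma sum_cut (V : nmodType) stop (F : seq T -> V) n w :
  (forall v, F v = \sum_x F (rcons v x)) ->
  \sum_(v <- cut stop n w) F v = F w.
Proof.
move=> FE; elim: n w => [|n IHn] w /=; first by rewrite big_seq1.
case: ifP => _; first by rewrite big_seq1.
rewrite big_flatten big_map big_enum /= FE.
by apply: eq_bigr => x _; exact: IHn.
Qed.

(** The counting form: when [F] is a 0-1 indicator passed on to at most one child, at most one leaf
    has the property. *)
Lemma leq_sum_cut stop (F : seq T -> nat) n w :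
  (forall v, (\sum_x F (rcons v x) <= F v)%N) ->
  (\sum_(v <- cut stop n w) F v <= F w)%N.
Proof.
move=> FE; elim: n w => [|n IHn] w /=; first by rewrite big_seq1.
case: ifP => _; first by rewrite big_seq1.
rewrite big_flatten big_map big_enum /=.
apply: leq_trans (FE w).
by apply: leq_sum => x _; exact: IHn.
Qed.

(** Being a prefix of a fixed word [u] passes from a word to at most one of its children, so the
    multiplicity of [u] is bounded by the indicator at the root [w]. *)
Lemma cut_uniq stop n w : uniq (cut stop n w).
Proof.
apply: count_mem_uniq => u; rewrite -has_pred1 has_count.
suff: (count_mem u (cut stop n w) <= 1)%N by case: count => [|[]].
rewrite -sum1_count big_mkcond /=.
apply: (@leq_trans (\sum_(v <- cut stop n w) prefix v u)).
  by apply: leq_sum => v _; case: eqP => // ->; rewrite prefix_refl.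
apply: (@leq_trans (prefix w u)); last by case: prefix.
apply: (@leq_sum_cut stop (fun v => prefix v u : nat)) => v.
case: (boolP (prefix v u)) => [/prefixP [s ->]|nvu]; last first.
  rewrite big1// => x _; case: (boolP (prefix _ _)) => // vx.
  by move: nvu; rewrite (prefix_trans _ vx)// prefix_rcons.
case: s => [|y s].
  rewrite big1// => x _; rewrite cats0; case: (boolP (prefix _ _)) => //.
  by move=> /size_prefix; rewrite size_rcons ltnn.
rewrite (bigD1 y)//= big1 => [|x xy]; first by case: prefix.
by rewrite -cats1 prefix_catr // eqxx /= (negbTE xy).
Qed.

(** The empty word is its own parent, hence the separate case [[::]] in the descriptions of leaves
    below. *)
Definition parent w := take (size w).-1 w.

Lemma parent_rcons w x : parent (rcons w x) = w.
Proof. by rewrite /parent size_rcons /= -cats1 take_size_cat. Qed.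

Lemma size_parent w : size (parent w) = (size w).-1.
Proof. by rewrite size_takel// leq_pred. Qed.

Definition monotone_stop stop := forall w x, stop w -> stop (rcons w x).
Definition bounded_stop stop := exists n, forall w, size w = n -> stop w.

Lemma monotone_cat stop w v : monotone_stop stop -> stop w -> stop (w ++ v).
Proof.
move=> ms sw; elim/last_ind: v => [|v x IHv]; first by rewrite cats0.
by rewrite -rcons_cat; exact: ms.
Qed.

Lemma mem_cut_stop stop n w v :
  (forall u, size u = (size w + n)%N -> stop u) -> v \in cut stop n w -> stop v.
Proof.
elim: n w => [|n IHn] w sn /=.
  by rewrite inE => /eqP ->; apply: sn; rewrite addn0.
case: ifP => [sw|_]; first by rewrite inE => /eqP ->.
move=> /flattenP [_ /mapP [x _ ->]]; apply: IHn => u.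
by rewrite size_rcons addSnnS; exact: sn.
Qed.

Lemma mem_cut_parent stop n w v :
  v \in cut stop n w -> v = w \/ (v <> [::] /\ ~~ stop (parent v)).
Proof.
elim: n w => [|n IHn] w /=; first by rewrite inE => /eqP ->; left.
case: ifPn => [sw|nsw]; first by rewrite inE => /eqP ->; left.
move=> /flattenP [_ /mapP [x _ ->]] /IHn [->|]; last by right.
by right; rewrite parent_rcons; split=> //; case: (w).
Qed.

(** If the parent has not stopped then, by monotonicity, no proper prefix has, so the recursion
    cannot halt before [w ++ v]; the fuel suffices because every word of full depth stops. *)
Lemma mem_cut stop n w v : monotone_stop stop ->
  (forall u, size u = (size w + n)%N -> stop u) ->
  stop (w ++ v) -> v = [::] \/ ~~ stop (parent (w ++ v)) ->
  w ++ v \in cut stop n w.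
Proof.
move=> ms; elim: n w v => [|n IHn] w [|x v] sn /= sv pv.
- by rewrite cats0 inE.
- case: pv => // /negP []; rewrite /parent size_cat /= addnS /= take_cat.
  rewrite ltnNge leq_addr /= addKn.
  by apply: monotone_cat => //; apply: sn; rewrite addn0.
- by rewrite cats0 in sv *; rewrite sv inE.
- case: pv => // pv; case: ifPn => [sw|nsw].
    case/negP: pv; rewrite /parent size_cat /= addnS /= take_cat.
    by rewrite ltnNge leq_addr /= addKn; exact: monotone_cat.
  apply/flattenP; exists (cut stop n (rcons w x)).
    by apply: map_f; rewrite mem_enum.
  rewrite -cat_rcons; apply: IHn; rewrite ?cat_rcons//; last by right.
  by move=> u; rewrite size_rcons addSnnS; exact: sn.
Qed.

(* Meaningful only for a [bounded_stop]: otherwise the depth is the junk value 0. *)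
Definition cutset stop :=
  cut stop (xget 0%N [set n | forall w, size w = n -> stop w]) [::].

Lemma sum_cutset (V : nmodType) stop (F : seq T -> V) :
  (forall v, F v = \sum_x F (rcons v x)) ->
  \sum_(v <- cutset stop) F v = F [::].
Proof. exact: sum_cut. Qed.

Lemma leq_sum_cutset stop (F : seq T -> nat) :
  (forall v, (\sum_x F (rcons v x) <= F v)%N) ->
  (\sum_(v <- cutset stop) F v <= F [::])%N.
Proof. exact: leq_sum_cut. Qed.

Lemma mem_cutset stop v : monotone_stop stop -> bounded_stop stop ->
  reflect (stop v /\ (v = [::] \/ ~~ stop (parent v))) (v \in cutset stop).
Proof.
move=> ms bs; rewrite /cutset; set m := xget _ _.
have sm : forall w, size w = m -> stop w.
  by rewrite /m; case: xgetP => [_ ->//|]; case: bs => n sn /(_ n).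
apply: (iffP idP) => [vc|[sv pv]].
  split; first by apply: mem_cut_stop vc => u; exact: sm.
  by case: (mem_cut_parent vc) => [->|[]]; [left|right].
by apply: (@mem_cut stop m [::]).
Qed.

End StoppingTime.

(** * Powers and pressure functions *)

Section RealPowers.
Set Implicit Arguments.
Unset Strict Implicit.
Context {R : realType}.

Lemma finite_lower_bound (T : finType) (f : T -> R) : (forall x, 0 < f x) ->
  exists k, [/\ 0 < k, k <= 1 & forall x, k <= f x].
Proof.
move=> f0; have s0 : 0 <= \sum_x (f x)^-1.
  by apply: sumr_ge0 => x _; rewrite invr_ge0 ltW.
(* Each reciprocal is at most the sum of all of them; the added 1 gives [k <= 1] and handles an
   empty [T]. *)
exists (1 + \sum_x (f x)^-1)^-1; split=> [||x].
- by rewrite invr_gt0 ltr_wpDr.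
- by rewrite invf_le1 ?lerDl// ltr_wpDr.
- rewrite -[leRHS]invrK lef_pV2 ?posrE ?invr_gt0 ?ltr_wpDr//.
  rewrite (bigD1 x)//= addrCA lerDl addr_ge0//.
  by apply: sumr_ge0 => y _; rewrite invr_ge0 ltW.
Qed.

Lemma finite_upper_bound (T : finType) (f : T -> R) : (forall x, f x < 1) ->
  exists k, [/\ 0 < k, k < 1 & forall x, f x <= k].
Proof.
move=> f1; have [x|k [k0 k1 fk]] := @finite_lower_bound T (fun x => 1 - f x).
  by rewrite subr_gt0.
(* Halving [k] keeps the bound positive even when [k = 1]. *)
exists (1 - k / 2); split=> [||x]; [lra|lra|].
by have := fk x; lra.
Qed.

Lemma expr_lt_eps (x e : R) : 0 <= x < 1 -> 0 < e -> exists n, x ^+ n < e.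
Proof.
move=> /andP[x0 x1] e0.
have /cvgrPdist_lt /(_ e e0) : GRing.exp x @ \oo --> (0 : R).
  by apply: cvg_expr; rewrite ger0_norm.
move=> [n _ /(_ n (leqnn n))] /=; rewrite sub0r normrN ger0_norm ?exprn_ge0//.
by exists n.
Qed.

(** With [|s|] in the exponents the bounds hold for either sign of [s], and they are reciprocal, so
    one constant serves on both sides. *)
Lemma powR_bounds (x k s : R) : 0 < k -> k <= x -> x <= 1 ->
  k `^ `|s| <= x `^ s <= k `^ (- `|s|).
Proof.
move=> k0 kx x1; have x0 : 0 < x by lra.
have le_s : x `^ `|s| <= x `^ s <= x `^ (- `|s|).
  by rewrite !ger_powR ?x0//= ?ler_norm// lerNl -normrN ler_norm.
have kxs : k `^ `|s| <= x `^ `|s|.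
  by apply: ge0_ler_powR; rewrite ?nnegrE//; lra.
have [l r] := andP le_s.
rewrite (le_trans kxs l)/= (le_trans r)// !powRN lef_pV2 ?posrE ?powR_gt0//.
Qed.

Lemma ltr_powR_base_lt1 (a t u : R) : 0 < a < 1 -> t < u -> a `^ u < a `^ t.
Proof.
move=> /andP[a0 a1] tu; rewrite /powR (gt_eqF a0) ltr_expR ltr_nM2r//.
by rewrite ln_lt0// a0.
Qed.

Section Pressure.
Context {T : finType} (k a : T -> R) (x0 : T).
Hypotheses (k0 : forall x, 0 < k x) (a01 : forall x, 0 < a x < 1).

Let pressure (t : R) := \sum_x k x * a x `^ t.

Lemma pressure_gt0 t : 0 < pressure t.
Proof.
rewrite /pressure (bigD1 x0)//= ltr_pwDl ?mulr_gt0 ?powR_gt0 ?k0//.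
  by case/andP: (a01 x0).
by apply: sumr_ge0 => x _; rewrite mulr_ge0 ?powR_ge0// ltW.
Qed.

Lemma pressure_decreasing t u : t < u -> pressure u < pressure t.
Proof.
move=> tu; rewrite /pressure (bigD1 x0)//= [ltRHS](bigD1 x0)//= ltr_leD//.
  by rewrite ltr_pM2l// ltr_powR_base_lt1.
apply: ler_sum => x _; rewrite ler_pM2l// ltW// ltr_powR_base_lt1//.
Qed.

Lemma pressure_continuous : continuous pressure.
Proof.
apply: continuous_big => [|x _ t]; first exact: add_continuous.
apply: cvgMr.
have -> : powR (a x) = expR \o (fun u => u * ln (a x)).
  by apply/funext => u; rewrite /powR gt_eqF//; case/andP: (a01 x).
apply: continuous_comp; last exact: continuous_expR.
by apply: cvgMl; exact: cvg_id.
Qed.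

Lemma pressure_unit : exists t, pressure t = 1.
Proof.
have [l [l0 l1 al]] := @finite_upper_bound T a (fun x => (andP (a01 x)).2).
(* The intermediate value theorem is used on [[-m, n]]: at [n] all bases are at most [l < 1], so the
   pressure is at most [pressure 0 * l ^+ n]; at [-m] the single term of [x0] already reaches 1. *)
have [n ln] : exists n, l ^+ n < (pressure 0)^-1.
  by apply: expr_lt_eps; rewrite ?invr_gt0 ?pressure_gt0// ltW.
have [m am] : exists m, a x0 ^+ m < k x0.
  by apply: expr_lt_eps => //; have := a01 x0; lra.
have p1 : pressure n%:R <= 1.
  apply: (@le_trans _ _ (pressure 0 * l ^+ n)).
    rewrite mulr_suml; apply: ler_sum => x _.
    have /andP[ax0 _] := a01 x.
    rewrite powRr0 mulr1 powR_mulrn ?(ltW ax0)// ler_pM2l//.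
    by rewrite lerXn2r ?nnegrE ?(ltW ax0) ?(ltW l0).
  rewrite mulrC -ler_pdivlMr ?pressure_gt0// mul1r; exact: ltW.
have p2 : 1 <= pressure (- m%:R).
  have /andP[ax0 _] := a01 x0.
  have h : 1 <= k x0 * a x0 `^ (- m%:R).
    rewrite powR_invn ?(ltW ax0)// ler_pdivlMr ?exprn_gt0// mul1r; exact: ltW.
  apply: (le_trans h); rewrite /pressure (bigD1 x0)//= lerDl.
  by apply: sumr_ge0 => x _; rewrite mulr_ge0 ?powR_ge0// ltW.
have mn : - m%:R <= n%:R :> R by rewrite lerNl (@le_trans _ _ 0)// oppr_le0.
have [||c _ pc] := @IVT R pressure (- m%:R) n%:R 1 mn; last by exists c.
  by apply: continuous_subspaceT; exact: pressure_continuous.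
by rewrite ge_min p1 orbT le_max p2.
Qed.

End Pressure.
End RealPowers.

(** After taking logarithms the constant contributes only [ln K / n], which tends to 0. *)
Lemma cvg_log_rate (R : realType) (u : R ^nat) (K x : R) : 0 < K -> 0 < x ->
  (forall n, K^-1 * x ^+ n <= u n <= K * x ^+ n) ->
  (fun n => n%:R^-1 * ln (u n)) @ \oo --> ln x.
Proof.
move=> K0 x0 ub.
(* The index is shifted since at [n = 0] the factor [n%:R^-1] is the default value 0. *)
have bnd n : ln x - ln K / n.+1%:R <= n.+1%:R^-1 * ln (u n.+1)
    <= ln x + ln K / n.+1%:R.
  have /andP[l r] := ub n.+1.
  have u0 : 0 < u n.+1.
    by apply: lt_le_trans l; rewrite mulr_gt0 ?invr_gt0 ?exprn_gt0.
  have n0 : 0 < n.+1%:R :> R by [].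
  have lnu : n.+1%:R * ln x - ln K <= ln (u n.+1) <= n.+1%:R * ln x + ln K.
    have Kx : ln (K^-1 * x ^+ n.+1) = n.+1%:R * ln x - ln K.
      rewrite lnM ?posrE ?invr_gt0 ?exprn_gt0// lnV ?posrE// lnXn//.
      by rewrite addrC mulr_natl.
    have Kx' : ln (K * x ^+ n.+1) = n.+1%:R * ln x + ln K.
      by rewrite lnM ?posrE ?exprn_gt0// lnXn// addrC mulr_natl.
    have xn0 : 0 < x ^+ n.+1 by rewrite exprn_gt0.
    rewrite -Kx -Kx'; apply/andP; split; rewrite ler_ln ?posrE//.
      by rewrite mulr_gt0 ?invr_gt0.
    by rewrite mulr_gt0.
  move/andP: lnu => [lnl lnr].
  have -> : ln x - ln K / n.+1%:R = n.+1%:R^-1 * (n.+1%:R * ln x - ln K).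
    by field; rewrite gt_eqF.
  have -> : ln x + ln K / n.+1%:R = n.+1%:R^-1 * (n.+1%:R * ln x + ln K).
    by field; rewrite gt_eqF.
  by rewrite !ler_pM2l ?invr_gt0// lnl lnr.
have K_cvg : ln K / n.+1%:R @[n --> \oo] --> (0 : R).
  rewrite -[X in _ --> X](mulr0 (ln K)); apply: cvgMr; exact: cvg_harmonic.
rewrite -cvg_shiftS.
apply: (@squeeze_cvgr _ _ _ _ (fun n => ln x - ln K / n.+1%:R)
  (fun n => ln x + ln K / n.+1%:R)).
- by apply: nearW => n; exact: bnd.
- by rewrite -[X in _ --> X]subr0; apply: cvgB => //; exact: cvg_cst.
- by rewrite -[X in _ --> X]addr0; apply: cvgD => //; exact: cvg_cst.
Qed.

(** * Consecutive intervals on the line *)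

Section Intervals.
Set Implicit Arguments.
Unset Strict Implicit.
Context {R : realType} {n : nat} (b d : 'I_n -> R).
Hypotheses (b0 : forall j, 0 < b j) (d0 : forall j, 0 <= d j).
Hypothesis d_last : forall j : 'I_n, j.+1 = n -> d j <= 1 - b j.
Hypothesis d_step : forall j k : 'I_n, k = j.+1 :> nat -> b j + d j <= d k.

Lemma intervals_ordered (j k : 'I_n) : (j < k)%N -> d j + b j <= d k.
Proof.
have [m] := ubnP (k - j)%N; elim: m j => // m IHm j kjm jk.
have [kj|kj] := eqVneq (k : nat) j.+1; first by rewrite addrC d_step.
have jn : (j.+1 < n)%N by rewrite (leq_ltn_trans jk).
apply: (@le_trans _ _ (d (Ordinal jn))); first by rewrite addrC d_step.
apply: (@le_trans _ _ (d (Ordinal jn) + b (Ordinal jn))).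
  by rewrite lerDl ltW.
by apply: IHm => /=; lia.
Qed.

Lemma interval_top j : d j + b j <= 1.
Proof.
have [jn|jn] := eqVneq j.+1 n; first by rewrite -lerBrDr d_last.
have n0 : (n.-1 < n)%N by have := ltn_ord j; lia.
have jl : (j < Ordinal n0)%N by rewrite /=; have := ltn_ord j; lia.
have := intervals_ordered jl; have := @d_last (Ordinal n0).
have := b0 (Ordinal n0) => bl /(_ _)/= dl jl'.
have : d (Ordinal n0) <= 1 - b (Ordinal n0) by apply: dl; lia.
by lra.
Qed.

Lemma interval_disjoint j k u :
  d j <= u < d j + b j -> d k <= u < d k + b k -> j = k.
Proof.
move=> uj uk; apply/val_inj; case: (ltngtP j k) => // jk.
- by exfalso; have := intervals_ordered jk; lra.
- by exfalso; have := intervals_ordered jk; lra.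
Qed.

(** Disjointness and inclusion in [[0, 1)] in one inequality between 0-1 counts, the shape that
    [leq_sum_cut] propagates along words. *)
Lemma sum_intervals u :
  (\sum_j (d j <= u < d j + b j)%R <= (0 <= u < 1)%R)%N.
Proof.
have [/existsP[j uj]|/existsPn nu] := boolP [exists j, d j <= u < d j + b j].
  rewrite (bigD1 j)//= big1 => [|k kj]; last first.
    case: (boolP (d k <= _ < _)) => // /(interval_disjoint uj) jk.
    by rewrite jk eqxx in kj.
  suff -> : 0 <= u < 1 by rewrite addn0 leq_b1.
  by have := interval_top j; have := d0 j; lra.
by rewrite big1// => j _; rewrite (negbTE (nu j)).
Qed.

End Intervals.

(** * Approximate squares of a carpet *)

Section Carpet.
Set Implicit Arguments.
Unset Strict Implicit.
Context {R : realType} {S : LG_system R}.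
Implicit Types (g : LG_index S) (j : 'I_(lg_m S)).
Implicit Types (w : seq (LG_index S)) (v : seq 'I_(lg_m S)).

Local Notation a g := (lg_a (tagged g)).
Local Notation c g := (lg_c (tagged g)).
Local Notation rows w := [seq tag g | g <- w].

Lemma lg_bd_le1 j : lg_d j + lg_b j <= 1.
Proof.
apply: interval_top; [exact: lg_b_gt0|exact: lg_d_last|exact: lg_d_step].
Qed.

Lemma lg_ac_le1 g : c g + a g <= 1.
Proof.
apply: (@interval_top R _ (@lg_a _ S (tag g)) (@lg_c _ S (tag g))).
- exact: lg_a_gt0.
- by move=> i /lg_c_last; lra.
- exact: lg_c_step.
Qed.

(** Strict because the offset [lg_d j] is positive. *)
Lemma lg_b_lt1 j : lg_b j < 1.
Proof. by have := lg_bd_le1 j; have := lg_d_gt0 j; lra. Qed.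

Lemma lg_a_lt1 g : a g < 1.
Proof. by rewrite (lt_trans (lg_a_lt_b _))// lg_b_lt1. Qed.

Lemma sum_row_intervals (u : R) :
  (\sum_(j < lg_m S) (lg_d j <= u < lg_d j + lg_b j)%R <= (0 <= u < 1)%R)%N.
Proof.
apply: sum_intervals; [exact: lg_b_gt0| |exact: lg_d_last|exact: lg_d_step].
by move=> j; rewrite ltW// lg_d_gt0.
Qed.

Lemma sum_index (V : nmodType) (F : LG_index S -> V) :
  \sum_g F g = \sum_j \sum_(i < lg_n j) F (Tagged (fun j => 'I_(lg_n j)) i).
Proof.
rewrite (sig_big_dep xpredT (fun=> xpredT)
  (fun j i => F (Tagged (fun j => 'I_(lg_n j)) i))) /=.
by apply: eq_bigr => -[].
Qed.

(** Two levels: [y] selects at most one row, and inside that row [u] selects at most one column. *)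
Lemma sum_cell_intervals (u y : R) :
  (\sum_(g : LG_index S) (lg_d (tag g) <= y < lg_d (tag g) + lg_b (tag g))%R *
     (c g <= u < c g + a g)%R <= (0 <= y < 1)%R * (0 <= u < 1)%R)%N.
Proof.
rewrite (sum_index (V := nat)) /=.
apply: leq_trans (leq_mul (sum_row_intervals y) (leqnn _)).
rewrite big_distrl /=; apply: leq_sum => j _.
rewrite -big_distrr /= leq_mul2l; apply/orP; right.
apply: sum_intervals; [exact: lg_a_gt0|exact: lg_c_ge0| |exact: lg_c_step].
by move=> i /lg_c_last; lra.
Qed.

Lemma a_word_rcons w g : a_word (rcons w g) = a_word w * a g.
Proof. by rewrite /a_word big_rcons. Qed.

Lemma b_word_rcons v j : b_word (rcons v j) = b_word v * lg_b j.
Proof. by rewrite /b_word big_rcons. Qed.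

Lemma b_word_nil : b_word ([::] : seq 'I_(lg_m S)) = 1.
Proof. by rewrite /b_word big_nil. Qed.

Lemma b_word_cat v v' : b_word (v ++ v') = b_word v * b_word v'.
Proof. by rewrite /b_word big_cat. Qed.

Lemma a_word_gt0 w : 0 < a_word w.
Proof. by apply: prodr_gt0 => g _; exact: lg_a_gt0. Qed.

Lemma b_word_gt0 v : 0 < b_word v.
Proof. by apply: prodr_gt0 => g _; exact: lg_b_gt0. Qed.

Lemma a_word_le_b w : a_word w <= b_word (rows w).
Proof.
rewrite /a_word /b_word big_map; apply: ler_prod => g _.
by rewrite !ltW ?lg_a_gt0 ?lg_a_lt_b.
Qed.

Definition small_a (r : R) w := a_word w < r.
Definition small_b (r : R) v := b_word v < r.
Definition long (l : nat) w := (l <= size w)%N.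

Lemma small_a_monotone r : monotone_stop (small_a r).
Proof.
move=> w g; apply: le_lt_trans; rewrite a_word_rcons ger_pMr ?a_word_gt0//.
exact: ltW (lg_a_lt1 g).
Qed.

Lemma small_b_monotone r : monotone_stop (small_b r).
Proof.
move=> w g; apply: le_lt_trans; rewrite b_word_rcons ger_pMr ?b_word_gt0//.
exact: ltW (lg_b_lt1 g).
Qed.

Lemma prod_small (T : finType) (f : T -> R) (r : R) : 0 < r ->
  (forall x, 0 < f x < 1) -> bounded_stop (fun w : seq T => \prod_(x <- w) f x < r).
Proof.
move=> r0 f01.
have [k [k0 k1 fk]] := @finite_upper_bound _ T f (fun x => (andP (f01 x)).2).
have [n kr] : exists n, k ^+ n < r by apply: expr_lt_eps; rewrite ?(ltW k0).
exists n => w wn; apply: le_lt_trans kr; rewrite -wn.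
elim: w {n wn} => [|x w IHw]; first by rewrite big_nil.
rewrite big_cons exprS; apply: ler_pM => //.
  by case/andP: (f01 x) => /ltW.
by apply: prodr_ge0 => y _; case/andP: (f01 y) => /ltW.
Qed.

Lemma small_a_bounded r : 0 < r -> bounded_stop (small_a r).
Proof. by move=> r0; apply: prod_small => // g; rewrite lg_a_gt0 lg_a_lt1. Qed.

Lemma small_b_bounded r : 0 < r -> bounded_stop (small_b r).
Proof. by move=> r0; apply: prod_small => // g; rewrite lg_b_gt0 lg_b_lt1. Qed.

Lemma long_monotone l : monotone_stop (long l).
Proof. by move=> w g; rewrite /long size_rcons; exact: leqW. Qed.

Lemma long_bounded l : bounded_stop (long l).
Proof. by exists l => w <-; rewrite /long. Qed.

Lemma mem_cutset_long l w : (w \in cutset (long l)) = (size w == l).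
Proof.
apply/(mem_cutset _ (@long_monotone l) (@long_bounded l))/eqP.
  rewrite /long size_parent => -[lw [w0|]]; last first.
    by move: lw; move: (size w) => n; lia.
  by move: lw; rewrite w0 /=; lia.
move=> <-; rewrite /long size_parent; split=> //.
by case: (w) => [|x s]; [left|right; rewrite -ltnNge].
Qed.

(* The approximate squares over the stopping time [stop]: a word of maps chosen
   by [stop], continued by rows until the height falls below the width. *)
Definition approx_squares (stop : pred (seq (LG_index S))) : seq (mixed_word S) :=
  [seq (w, v) | w <- cutset stop,
     v <- cutset (small_b (a_word w / b_word (rows w)))].

Lemma approxP stop (s : mixed_word S) : monotone_stop stop -> bounded_stop stop ->
  reflect [/\ stop s.1, s.1 = [::] \/ ~~ stop (parent s.1), s.2 <> [::],
    a_word s.1 <= b_word (rows s.1) * b_word (parent s.2) &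
    b_word (y_word s) < a_word s.1] (s \in approx_squares stop).
Proof.
case: s => w v ms bs; rewrite /y_word b_word_cat /=.
have r0 : 0 < a_word w / b_word (rows w) by rewrite divr_gt0 ?a_word_gt0 ?b_word_gt0.
have Wb := b_word_gt0 (rows w).
have mb := mem_cutset v (@small_b_monotone _) (small_b_bounded r0).
apply: (iffP idP) => [/allpairsPdep [w' [v' [ww vv [ew ev]]]]|[sw pw v0 av bv]].
  subst w' v'.
  move/(mem_cutset _ ms bs): ww => [sw pw].
  move/mb: vv; rewrite /small_b !ltr_pdivlMr// -!leNgt.
  rewrite !(mulrC _ (b_word (rows w))) => -[bv pv].
  (* The empty word has height factor 1, while the threshold is at most 1 as widths do not exceed
     heights. *)
  have v0 : v <> [::].
    move=> v0; move: bv; rewrite v0 b_word_nil mulr1.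
    by rewrite ltNge a_word_le_b.
  by split=> //; case: pv.
apply/allpairsPdep; exists w, v; split=> //; first exact/(mem_cutset _ ms bs).
apply/mb; rewrite /small_b !ltr_pdivlMr// -!leNgt.
by rewrite !(mulrC _ (b_word (rows w))); split=> //; right.
Qed.

Lemma sum_approx (V : nmodType) stop (F : mixed_word S -> V) :
  \sum_(s <- approx_squares stop) F s = \sum_(w <- cutset stop)
    \sum_(v <- cutset (small_b (a_word w / b_word (rows w)))) F (w, v).
Proof. by rewrite /approx_squares big_allpairs_dep. Qed.

Lemma approx_uniq stop : uniq (approx_squares stop).
Proof.
apply: allpairs_uniq_dep => [|w _|[w v] [w' v'] _ _ [-> ->//]].
  exact: cut_uniq.
exact: cut_uniq.
Qed.

(** Fixing the length [l] is itself a stopping time, so [Psi l] is a special case of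
    [approx_squares] and is carried by a duplicate-free list. *)
Lemma Psi_approx l : Psi l = [set` approx_squares (long l)].
Proof.
apply/seteqP; split=> [[w v]|[w v]]; rewrite /Psi /=.
  move=> [wl v0 av bv]; apply/(approxP _ (@long_monotone l) (@long_bounded l)).
  have := mem_cutset_long l w; rewrite wl eqxx.
  move=> /(mem_cutset _ (@long_monotone l) (@long_bounded l)) [sw pw].
  split=> //=; first by case: (v) v0.
  (* Since [v] is non-empty, dropping the last letter of the full row word drops that of [v]. *)
  move: av; rewrite /y_word_init /y_word /= size_cat size_map.
  rewrite take_cat size_map; case: (v) v0 => //= j v' _.
  by rewrite addnS /= ltnNge leq_addr /= addKn b_word_cat.
move=> /(approxP _ (@long_monotone l) (@long_bounded l)) /= [sw pw v0 av bv].
have : w \in cutset (long l).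
  exact/(mem_cutset _ (@long_monotone l) (@long_bounded l)).
rewrite mem_cutset_long => /eqP wl; split=> //; first by case: (v) v0.
move: av; rewrite /y_word_init /y_word /= size_cat size_map take_cat size_map.
case: (v) v0 => //= j v' _.
by rewrite addnS /= ltnNge leq_addr /= addKn b_word_cat.
Qed.

End Carpet.

(** * Weights of approximate squares *)

Section Weights.
Set Implicit Arguments.
Unset Strict Implicit.
Context {R : realType} {S : LG_system R} (p : LG_index S -> R).
Hypothesis hp : positive_probability_vector p.
Implicit Types (g : LG_index S) (j : 'I_(lg_m S)).
Implicit Types (w : seq (LG_index S)) (v : seq 'I_(lg_m S)).

Local Notation a g := (lg_a (tagged g)).
Local Notation rows w := [seq tag g | g <- w].

Let j0 : 'I_(lg_m S) := Ordinal (lg_m_ge1 S).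
Let g0 : LG_index S := Tagged (fun j => 'I_(lg_n j)) (Ordinal (lg_n_ge1 j0)).

Lemma row_prob_gt0 j : 0 < row_prob p j.
Proof.
rewrite /row_prob (bigD1 (Ordinal (lg_n_ge1 j)))//= ltr_pwDl ?hp.1//.
by apply: sumr_ge0 => i _; rewrite ltW// hp.1.
Qed.

Lemma p_word_rcons w g : p_word p (rcons w g) = p_word p w * p g.
Proof. by rewrite /p_word big_rcons. Qed.

Lemma q_word_rcons v j : q_word p (rcons v j) = q_word p v * row_prob p j.
Proof. by rewrite /q_word big_rcons. Qed.

Lemma p_word_gt0 w : 0 < p_word p w.
Proof. by apply: prodr_gt0 => g _; rewrite hp.1. Qed.

Lemma q_word_gt0 v : 0 < q_word p v.
Proof. by apply: prodr_gt0 => g _; exact: row_prob_gt0. Qed.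

Definition word_mass (s : mixed_word S) := p_word p s.1 * q_word p s.2.

Lemma word_mass_gt0 s : 0 < word_mass s.
Proof. by rewrite mulr_gt0 ?p_word_gt0 ?q_word_gt0. Qed.

Context (q : R).

(* [beta] is the exponent of the projection of the measure to the y-axis. *)
Lemma row_exponent :
  exists beta, \sum_j row_prob p j `^ q * lg_b j `^ beta = 1.
Proof.
apply: (pressure_unit j0) => j; first by rewrite powR_gt0 ?row_prob_gt0.
by rewrite lg_b_gt0 lg_b_lt1.
Qed.

Context (beta : R).
Hypothesis betaE : \sum_j row_prob p j `^ q * lg_b j `^ beta = 1.

Let rowWeight v := q_word p v `^ q * b_word v `^ beta.

Let rowWeight_harmonic v : rowWeight v = \sum_j rowWeight (rcons v j).
Proof.
rewrite -[LHS]mulr1 -betaE mulr_sumr; apply: eq_bigr => j _.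
rewrite /rowWeight q_word_rcons b_word_rcons.
rewrite !powRM ?ltW ?q_word_gt0 ?row_prob_gt0 ?b_word_gt0 ?lg_b_gt0//.
by ring.
Qed.

Definition growth (t : R) :=
  \sum_(g : LG_index S) p g `^ q * lg_b (tag g) `^ beta * a g `^ (t - beta).

Lemma growth_gt0 t : 0 < growth t.
Proof.
apply: (pressure_gt0 g0) => g; rewrite ?mulr_gt0 ?powR_gt0 ?lg_b_gt0 ?hp.1//.
by rewrite lg_a_gt0 lg_a_lt1.
Qed.

Lemma growth_decreasing t u : t < u -> growth u < growth t.
Proof.
move=> tu; apply: (pressure_decreasing g0) => [g|g|]; last by rewrite ltrD2r.
  by rewrite mulr_gt0 ?powR_gt0 ?lg_b_gt0 ?hp.1.
by rewrite lg_a_gt0 lg_a_lt1.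
Qed.

Lemma growth_unit : exists t, growth t = 1.
Proof.
have [||t tE] := @pressure_unit R _
  (fun g => p g `^ q * lg_b (tag g) `^ beta) (fun g => a g) g0.
- by move=> g; rewrite mulr_gt0 ?powR_gt0 ?lg_b_gt0 ?hp.1.
- by move=> g; rewrite lg_a_gt0 lg_a_lt1.
by exists (t + beta); rewrite /growth addrK.
Qed.

Let mapWeight t w :=
  p_word p w `^ q * b_word (rows w) `^ beta * a_word w `^ (t - beta).

(** A step down the tree multiplies the total weight by [growth t]; so the weight is harmonic when
    [growth t = 1], and in general after division by [growth t ^+ size w]. *)
Let mapWeight_growth t w :
  mapWeight t w * growth t = \sum_g mapWeight t (rcons w g).
Proof.
rewrite mulr_sumr; apply: eq_bigr => g _.
rewrite /mapWeight map_rcons p_word_rcons b_word_rcons a_word_rcons.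
rewrite !powRM ?ltW ?p_word_gt0 ?a_word_gt0 ?b_word_gt0 ?lg_b_gt0 ?lg_a_gt0 ?hp.1//.
by ring.
Qed.

(** The row weights of the completions of [w] sum to 1, which spreads the weight of [w] over its
    approximate squares; each share then differs from the summand only by a bounded factor. *)
Lemma sum_approx_bounds : exists2 K : R, 0 < K &
  forall stop t, monotone_stop stop -> bounded_stop stop ->
    K^-1 * \sum_(w <- cutset stop) mapWeight t w <=
      \sum_(s <- approx_squares stop) word_mass s `^ q * a_word s.1 `^ t <=
      K * \sum_(w <- cutset stop) mapWeight t w.
Proof.
have [k [k0 k1 kb]] := finite_lower_bound (@lg_b_gt0 _ S).
pose K := k `^ (- `|beta|); have K0 : 0 < K by rewrite powR_gt0.
exists K => // stop t ms bs.
have -> : \sum_(w <- cutset stop) mapWeight t w =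
    \sum_(s <- approx_squares stop) mapWeight t s.1 * rowWeight s.2.
  rewrite sum_approx; apply: eq_bigr => w _ /=; rewrite -mulr_sumr.
  rewrite (sum_cutset _ rowWeight_harmonic) /rowWeight /q_word /b_word.
  by rewrite !big_nil !powR1 !mulr1.
have bnd s : s \in approx_squares stop ->
    K^-1 * (mapWeight t s.1 * rowWeight s.2) <= word_mass s `^ q * a_word s.1 `^ t
      <= K * (mapWeight t s.1 * rowWeight s.2).
  case: s => w v /(approxP _ ms bs) [_ _ v0 /= pv]; rewrite /y_word /= => bv.
  (* [u] is the ratio of height to width of the approximate square, and its power with exponent
     [beta] is exactly the factor between the two terms. *)
  pose u := b_word (rows w ++ v) / a_word w.
  have a0 := a_word_gt0 w; have b0 := b_word_gt0 (rows w ++ v).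
  have u0 : 0 < u by rewrite divr_gt0.
  have -> : mapWeight t w * rowWeight v =
      word_mass (w, v) `^ q * a_word w `^ t * u `^ beta.
    rewrite /mapWeight /rowWeight /word_mass /u b_word_cat /=.
    rewrite !powRM ?ltW ?p_word_gt0 ?q_word_gt0 ?invr_gt0 ?mulr_gt0 ?b_word_gt0//.
    rewrite -powR_inv1 ?ltW// -powRrM mulN1r powRD; first by ring.
    by rewrite (gt_eqF a0) implybT.
  have X0 : 0 < word_mass (w, v) `^ q * a_word w `^ t.
    by rewrite mulr_gt0 ?powR_gt0 ?word_mass_gt0.
  have /andP[ul ur] : k `^ `|beta| <= u `^ beta <= K.
    apply: powR_bounds => //; last by rewrite ler_pdivrMr// mul1r ltW.
    (* Before its last letter the height was at least the width, and one letter costs at most a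
       factor [k]. *)
    rewrite ler_pdivlMr//; case/lastP: v v0 pv {bv u u0 b0 X0} => // v j _.
    rewrite parent_rcons b_word_cat b_word_rcons mulrA => pv.
    by rewrite mulrC; apply: ler_pM => //; apply: ltW.
  apply/andP; split.
    by rewrite mulrCA ger_pMr// mulrC ler_pdivrMr// mul1r.
  by rewrite mulrCA ler_pMr// -ler_pdivrMl// mulr1 /K powRN invrK.
rewrite !mulr_sumr !big_seq; apply/andP; split; apply: ler_sum => s /bnd /andP[//].
Qed.

Lemma Psi_sumE t l : Psi_sum p q t l =
  \sum_(s <- approx_squares (long l)) word_mass s `^ q * a_word s.1 `^ t.
Proof. by rewrite /Psi_sum Psi_approx -fsbig_seq// approx_uniq. Qed.

Lemma cvg_Psi_sum t :
  (fun l => l%:R^-1 * ln (Psi_sum p q t l)) @ \oo --> ln (growth t).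
Proof.
have [K K0 bnd] := sum_approx_bounds; have r0 := growth_gt0 t.
apply: (@cvg_log_rate R (Psi_sum p q t) K _ K0 r0) => l; rewrite Psi_sumE.
suff <- : \sum_(w <- cutset (long l)) mapWeight t w = growth t ^+ l.
  by apply: bnd; [exact: long_monotone|exact: long_bounded].
pose F w := mapWeight t w * growth t ^- size w.
have FE w : F w = \sum_g F (rcons w g).
  under eq_bigr do rewrite /F size_rcons.
  rewrite -mulr_suml -mapWeight_growth exprS invfM mulrA mulfK//.
  by rewrite gt_eqF.
transitivity (\sum_(w <- cutset (long l)) F w * growth t ^+ l).
  rewrite !big_seq; apply: eq_bigr => w; rewrite mem_cutset_long => /eqP wl.
  by rewrite /F wl divfK// expf_neq0// gt_eqF.
rewrite -mulr_suml (sum_cutset _ FE) /F /mapWeight /p_word /b_word /a_word.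
by rewrite !big_nil !powR1 !mul1r expr0 invr1 mul1r.
Qed.

Lemma Psi_equation_unique t : Psi_equation p q t <-> growth t = 1.
Proof.
rewrite /Psi_equation; split=> [Pt|tE].
  apply: ln_inj; rewrite ?posrE ?growth_gt0// ln1.
  exact: (cvg_unique (@norm_hausdorff _ R) (@cvg_Psi_sum t) Pt).
by have := @cvg_Psi_sum t; rewrite tE ln1.
Qed.

(** For this [t] the map weights sum to 1 over any cutset; stopping at width below [r] makes all
    widths comparable to [r], so the power of [a_word] can be pulled out as a power of [r]. *)
Lemma sum_approx_small t : growth t = 1 -> exists2 K : R, 0 < K &
  forall r, 0 < r <= 1 ->
    K^-1 * r `^ (- t) <=
      \sum_(s <- approx_squares (small_a r)) word_mass s `^ q <= K * r `^ (- t).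
Proof.
move=> tE; have [K K0 bnd] := sum_approx_bounds.
have [k [k0 k1 ka]] := @finite_lower_bound _ (LG_index S) (fun g => a g)
  (fun g => lg_a_gt0 _).
pose L := k `^ (- `|t|); have L0 : 0 < L by rewrite powR_gt0.
exists (K * L) => [|r /andP[r0 r1]]; first by rewrite mulr_gt0.
have ms := @small_a_monotone _ S r; have bs := @small_a_bounded _ S _ r0.
have sum1 : \sum_(w <- cutset (small_a r)) mapWeight t w = 1.
  rewrite (@sum_cutset _ _ _ (mapWeight t)) => [|w].
    by rewrite /mapWeight /p_word /b_word /a_word !big_nil !powR1 !mul1r.
  by rewrite -mapWeight_growth tE mulr1.
have {bnd} := bnd _ t ms bs; rewrite sum1 !mulr1.
set A := \sum_(s <- _) _; set B := \sum_(s <- _) _ => /andP[lA rA].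
have rt : 0 < r `^ t by rewrite powR_gt0.
have a_near (s : mixed_word S) : s \in approx_squares (small_a r) ->
    L^-1 * r `^ t <= a_word s.1 `^ t <= L * r `^ t.
  move=> /(approxP _ ms bs) [sr pr _ _ _].
  have /andP[ul ur] : k `^ `|t| <= (a_word s.1 / r) `^ t <= L.
    apply: powR_bounds => //; last by rewrite ler_pdivrMr// mul1r ltW.
    rewrite ler_pdivlMr//; move: sr pr; case/lastP: s.1 => [|w g].
      (* The empty word has width 1 and cannot be below [r <= 1], so a last letter exists. *)
      by rewrite /small_a /a_word big_nil; lra.
    rewrite parent_rcons /small_a a_word_rcons -leNgt mulrC => _ [|rw].
      by case: (w).
    by apply: ler_pM => //; apply: ltW.
  have -> : a_word s.1 `^ t = (a_word s.1 / r) `^ t * r `^ t.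
    by rewrite -powRM ?divfK ?gt_eqF// ltW ?divr_gt0 ?a_word_gt0.
  by rewrite !ler_pM2r// ur andbT /L powRN invrK.
have lAB : L^-1 * r `^ t * A <= B.
  rewrite mulr_sumr /B !big_seq; apply: ler_sum => s /a_near /andP[l _].
  by rewrite mulrC ler_pM2l// powR_gt0// word_mass_gt0.
have rAB : B <= L * r `^ t * A.
  rewrite mulr_sumr /B !big_seq; apply: ler_sum => s /a_near /andP[_ l].
  by rewrite [leRHS]mulrC ler_pM2l// powR_gt0// word_mass_gt0.
rewrite powRN; apply/andP; split.
  rewrite ler_pdivrMr// -[leLHS]mulr1 ler_pdivrMl ?mulr_gt0//.
  have : K^-1 * 1 <= L * r `^ t * A by rewrite mulr1 (le_trans lA).
  rewrite ler_pdivrMl// => /le_trans; apply.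
  by rewrite -!mulrA [A * _]mulrC.
rewrite ler_pdivlMr//; have := le_trans lAB rA.
by rewrite -mulrA ler_pdivrMl// mulrC [L * K]mulrC.
Qed.

End Weights.

(** * Geometry of approximate squares *)

Lemma itv_rescale (R : realFieldType) (o s x l z : R) : 0 < s ->
  (o + s * x <= z < o + s * x + s * l) = (x <= (z - o) / s < x + l).
Proof.
by move=> s0; rewrite ler_pdivlMr// ltr_pdivrMr// lerBrDl ltrBlDl; congr (_ && _);
  rewrite ?mulrDl !(mulrC s) ?addrA.
Qed.

(** The length is at least the mesh [e], so a grid point lies in the interval; the interval is no
    longer than one block of [L] steps and meets block [k], which leaves the indices from
    [L * (k - 1)] to [L * (k + 2)]. *)
Lemma grid_point (R : realType) (e x l : R) (L : nat) (k : int) :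
  0 < e -> e <= l <= L%:R * e ->
  (exists2 y, x <= y <= x + l & k%:~R * (L%:R * e) <= y < (k + 1)%:~R * (L%:R * e)) ->
  exists i : 'I_(3 * L).+1,
    x <= (L%:Z * (k - 1) + i%:Z)%:~R * e < x + l.
Proof.
move=> e0 /andP[el lL] [y /andP[xy yl] /andP[ky yk]].
pose m := Num.ceil (x / e).
have /andP[m1 m2] : (m%:~R - 1) * e < x <= m%:~R * e.
  have := ceil_itv (x / e); rewrite -/m intrB => /andP[h1 h2].
  by rewrite -ltr_pdivlMr// -ler_pdivrMr// h1 h2.
have lo : (L%:Z * (k - 1) <= m)%R.
  rewrite -(ler_int R) intrM intrB; move: ky; rewrite -pmulrn => ky.
  rewrite -(ler_pM2r e0); nra.
have hi : (m <= L%:Z * (k + 2))%R.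
  rewrite -ltzD1 -(ltr_int R) intrD intrM intrD.
  move: yk; rewrite intrD -!pmulrn => yk.
  rewrite -(ltr_pM2r e0); nra.
have im : (`|(m - L%:Z * (k - 1))%R|%N < (3 * L).+1)%N by lia.
exists (Ordinal im) => /=.
have -> : L%:Z * (k - 1) + (absz (m - L%:Z * (k - 1))%R)%:Z = m by lia.
by rewrite m2 /=; lra.
Qed.

Section Geometry.
Set Implicit Arguments.
Unset Strict Implicit.
Context {R : realType} {S : LG_system R}.
Implicit Types (g : LG_index S) (j : 'I_(lg_m S)).
Implicit Types (w : seq (LG_index S)) (v : seq 'I_(lg_m S)).
Implicit Types (s : mixed_word S) (z : R * R).

Local Notation a g := (lg_a (tagged g)).
Local Notation c g := (lg_c (tagged g)).
Local Notation rows w := [seq tag g | g <- w].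

Fixpoint x_offset w : R := if w is g :: w' then c g + a g * x_offset w' else 0.
Fixpoint y_offset v : R :=
  if v is j :: v' then lg_d j + lg_b j * y_offset v' else 0.

Lemma x_offset_rcons w g :
  x_offset (rcons w g) = x_offset w + a_word w * c g.
Proof.
elim: w => [|h w IHw] /=; first by rewrite /a_word big_nil; ring.
by rewrite IHw /a_word big_cons; ring.
Qed.

Lemma y_offset_cat v v' :
  y_offset (v ++ v') = y_offset v + b_word v * y_offset v'.
Proof.
elim: v => [|j v IHv] /=; first by rewrite b_word_nil; ring.
by rewrite IHv /b_word big_cons; ring.
Qed.

Lemma y_offset_rcons v j : y_offset (rcons v j) = y_offset v + b_word v * lg_d j.
Proof. by rewrite -cats1 y_offset_cat /= mulr0 addr0. Qed.

Definition word_map w z : R * R :=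
  (a_word w * z.1 + x_offset w, b_word (rows w) * z.2 + y_offset (rows w)).

Lemma word_map_rcons w g z : word_map (rcons w g) z = word_map w (LG_map g z).
Proof.
rewrite /word_map map_rcons a_word_rcons b_word_rcons x_offset_rcons.
by rewrite y_offset_rcons /LG_map /=; congr pair; ring.
Qed.

(* The image of [0, 1] x [0, 1] under the composition of the maps in [s.1] and
   the contractions of the y-axis in [s.2]. *)
Definition cell s : set (R * R) :=
  [set z | x_offset s.1 <= z.1 <= x_offset s.1 + a_word s.1 /\
           y_offset (y_word s) <= z.2 <= y_offset (y_word s) + b_word (y_word s)].

(** Closed cells may share edges; the half-open ones are disjoint, which is what the counting
    needs. *)
Definition half_open_y v z := y_offset v <= z.2 < y_offset v + b_word v.

Definition half_open_cell s z :=
  half_open_y (y_word s) z && (x_offset s.1 <= z.1 < x_offset s.1 + a_word s.1).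

Lemma sum_half_open_y v z :
  (\sum_j half_open_y (rcons v j) z <= half_open_y v z)%N.
Proof.
rewrite /half_open_y.
under eq_bigr do rewrite y_offset_rcons b_word_rcons itv_rescale ?b_word_gt0//.
apply: (leq_trans (sum_row_intervals _)).
have := @itv_rescale _ (y_offset v) (b_word v) 0 1 z.2 (b_word_gt0 v).
by rewrite mulr0 addr0 mulr1 add0r => <-.
Qed.

(** First the row completions of a fixed [w] are collapsed into the strip of its rows, then the
    words [w] are collapsed into the unit square; each time the indicators of the children add up to
    at most that of the parent. *)
Lemma half_open_cells_disjoint stop z :
  (\sum_(s <- approx_squares stop) half_open_cell s z <= 1)%N.
Proof.
pose X w := x_offset w <= z.1 < x_offset w + a_word w.
rewrite sum_approx.
apply: (@leq_trans (\sum_(w <- cutset stop) half_open_y (rows w) z * X w)).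
  apply: leq_sum => w _.
  rewrite /half_open_cell /y_word /=; under eq_bigr do rewrite -mulnb.
  rewrite -big_distrl leq_mul2r; apply/orP; right.
  apply: leq_trans (leq_sum_cutset (F := fun v => half_open_y (rows w ++ v) z) _ _) _.
    by move=> v; under eq_bigr do rewrite -rcons_cat; exact: sum_half_open_y.
  by rewrite cats0.
apply: leq_trans (leq_b1 (half_open_y [::] z && X [::])).
rewrite -mulnb.
apply: (@leq_sum_cutset _ stop (fun w => half_open_y (rows w) z * X w)%N) => w.
rewrite /half_open_y /X.
under eq_bigr do rewrite map_rcons y_offset_rcons x_offset_rcons b_word_rcons
  a_word_rcons !itv_rescale ?b_word_gt0 ?a_word_gt0//.
apply: (leq_trans (sum_cell_intervals _ _)).
have := @itv_rescale _ (y_offset (rows w)) (b_word (rows w)) 0 1 z.2 (b_word_gt0 _).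
rewrite mulr0 addr0 mulr1 add0r => <-.
have := @itv_rescale _ (x_offset w) (a_word w) 0 1 z.1 (a_word_gt0 _).
by rewrite mulr0 addr0 mulr1 add0r => <-.
Qed.

Definition meets_square n s k := `[< cell s `&` dyadic_square n k !=set0 >].

(** A stopping rule overshoots by at most one letter: one factor for the width against [r], a second
    for the height against the width. *)
Lemma approx_small_size : exists2 kappa : R, 0 < kappa <= 1 &
  forall (r : R) s, 0 < r <= 1 -> s \in approx_squares (@small_a _ S r) ->
    [/\ kappa * r <= a_word s.1, a_word s.1 < r,
        kappa * r <= b_word (y_word s) & b_word (y_word s) < r].
Proof.
have [k [k0 k1 ka]] := @finite_lower_bound _ (LG_index S) (fun g => a g)
  (fun g => lg_a_gt0 _).
have [k' [k'0 k'1 kb]] := finite_lower_bound (@lg_b_gt0 _ S).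
exists (k * k') => [|r s /andP[r0 r1]]; first by rewrite mulr_gt0// mulr_ile1// ltW.
move=> /(approxP _ (@small_a_monotone _ S r) (@small_a_bounded _ S _ r0)).
move=> [sr pr v0 pv bv].
have ar : k * r <= a_word s.1.
  move: sr pr {pv bv}; case/lastP: s.1 => [|w g].
    by rewrite /small_a /a_word big_nil; lra.
  rewrite parent_rcons /small_a a_word_rcons -leNgt mulrC => _ [|rw].
    by case: (w).
  by apply: ler_pM => //; apply: ltW.
have kr : k * k' * r <= k * r by rewrite ler_pM2r// ler_piMr// ltW.
split=> //; first exact: le_trans ar.
  move: v0 pv {bv}; rewrite /y_word b_word_cat; case/lastP: s.2 => // v j _.
  rewrite parent_rcons b_word_rcons => pv.
  rewrite mulrAC mulrA; apply: ler_pM; rewrite ?(ltW k'0) ?kb//.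
    by rewrite mulr_ge0 ?ltW.
  exact: le_trans pv.
exact: lt_trans bv sr.
Qed.

Lemma count_meets : exists M : nat, forall n k,
  (count (fun s => meets_square n s k) (approx_squares (@small_a _ S (2 ^- n))) <= M)%N.
Proof.
have [kappa /andP[ka0 ka1] sz] := approx_small_size.
(* [L] makes the mesh [r / L] at most [kappa * r], hence at most both sides of every cell. *)
pose L := Num.bound kappa^-1.
have L1 : 1 <= L%:R * kappa.
  by rewrite -ler_pdivrMr// mul1r ltW// archi_boundP// invr_ge0 ltW.
exists ((3 * L).+1 * (3 * L).+1)%N => n k.
pose r : R := 2 ^- n; pose e := r / L%:R.
have r0 : 0 < r by rewrite invr_gt0 exprn_gt0.
have r1 : r <= 1 by rewrite invf_le1 ?exprn_gt0// exprn_ege1// ler1n.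
have L0 : 0 < L%:R :> R by rewrite -(pmulr_lgt0 _ ka0); lra.
have e0 : 0 < e by rewrite divr_gt0.
have rE : r = L%:R * e by rewrite mulrC divfK// gt_eqF.
pose pt (i : 'I_(3 * L).+1 * 'I_(3 * L).+1) : R * R :=
  ((L%:Z * (k.1 - 1) + i.1%:Z)%:~R * e, (L%:Z * (k.2 - 1) + i.2%:Z)%:~R * e).
rewrite -sum1_count big_mkcond /=.
(* Every cell that meets square [k] has one of the points [pt i] in its half-open version; once the
   sums are exchanged, each point is counted at most once. *)
apply: (@leq_trans (\sum_(s <- approx_squares (@small_a _ S r))
    \sum_i half_open_cell s (pt i))).
  rewrite !big_seq; apply: leq_sum => s sr; case: ifP => // /asboolP.
  have [ka ar kb br] := sz r s (introT andP (conj r0 r1)) sr.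
  have ek : e <= kappa * r by rewrite ler_pdivrMr// mulrAC ler_peMl ?(ltW r0)// mulrC.
  move=> [z [[zx zy] [dx dy]]].
  have [||i1 hi1] := @grid_point R e (x_offset s.1) (a_word s.1) L k.1 e0.
  - by rewrite -rE (le_trans ek ka) ltW.
  - by exists z.1 => //; rewrite -rE.
  have [||i2 hi2] := @grid_point R e (y_offset (y_word s)) (b_word (y_word s)) L k.2 e0.
  - by rewrite -rE (le_trans ek kb) ltW.
  - by exists z.2 => //; rewrite -rE.
  by rewrite (bigD1 (i1, i2))//= /half_open_cell /half_open_y /pt /= hi1 hi2.
rewrite exchange_big /=.
apply: (@leq_trans (\sum_(i : 'I_(3 * L).+1 * 'I_(3 * L).+1) 1)).
  by apply: leq_sum => i _; exact: half_open_cells_disjoint.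
by rewrite sum1_card card_prod !card_ord.
Qed.

Definition dyadic_index n z : int * int :=
  (Num.floor (z.1 / 2 ^- n), Num.floor (z.2 / 2 ^- n)).

Lemma dyadic_squareP n k z : dyadic_square n k z <-> k = dyadic_index n z.
Proof.
have r0 : 0 < 2 ^- n :> R by rewrite invr_gt0 exprn_gt0.
have itvP (m : int) (x : R) :
    m%:~R * 2 ^- n <= x < (m + 1)%:~R * 2 ^- n <-> m = Num.floor (x / 2 ^- n).
  rewrite -ler_pdivlMr// -ltr_pdivrMr//; split; first by move/floor_def.
  by move=> ->; exact: floor_itv.
case: k => k1 k2; split=> [[/itvP e1 /itvP e2]|[/itvP e1 /itvP e2]].
  by rewrite /dyadic_index -e1 -e2.
by split.
Qed.

Lemma dyadic_square_inj n : injective (@dyadic_square R n).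
Proof.
move=> k k' kk'; have r0 : 0 < 2 ^- n :> R by rewrite invr_gt0 exprn_gt0.
pose z : R * R := (k.1%:~R * 2 ^- n, k.2%:~R * 2 ^- n).
have : dyadic_square n k z.
  by rewrite /dyadic_square /= !lexx !ltr_pM2r// !ltr_int !ltzD1 !lexx.
by move=> kz; move: (kz); rewrite kk' => /dyadic_squareP ->; apply/dyadic_squareP.
Qed.

Definition nearby n s : seq (int * int) :=
  let k := dyadic_index n (x_offset s.1, y_offset (y_word s)) in
  [seq (k.1 + i, k.2 + i') | i <- [:: 0; 1], i' <- [:: 0; 1]].

(** Both sides of the cell are shorter than the mesh, so each index exceeds that of the lower-left
    corner by 0 or 1. *)
Lemma nearbyP n s z : s \in approx_squares (@small_a _ S (2 ^- n)) ->
  cell s z -> dyadic_index n z \in nearby n s.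
Proof.
have r0 : 0 < 2 ^- n :> R by rewrite invr_gt0 exprn_gt0.
have r1 : 2 ^- n <= 1 :> R by rewrite invf_le1 ?exprn_gt0// exprn_ege1// ler1n.
have [kappa _ sz] := approx_small_size.
move=> /(sz _ _ (introT andP (conj r0 r1))) [_ ar _ br] [zx zy].
have near (o l x : R) : l < 2 ^- n -> o <= x <= o + l ->
    Num.floor (x / 2 ^- n) = Num.floor (o / 2 ^- n) + 0 \/
    Num.floor (x / 2 ^- n) = Num.floor (o / 2 ^- n) + 1.
  move=> lr /andP[ox xo].
  have lo : Num.floor (o / 2 ^- n) <= Num.floor (x / 2 ^- n).
    by rewrite floor_ge_int (le_trans (floor_le _))// ler_pM2r ?invr_gt0.
  have hi : Num.floor (x / 2 ^- n) < Num.floor (o / 2 ^- n) + 2.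
    have := floorD1_gt (o / 2 ^- n); rewrite floor_lt_int !intrD => of1.
    have : x / 2 ^- n < o / 2 ^- n + 1.
      by rewrite ltr_pdivrMr// mulrDl divfK ?gt_eqF// mul1r; lra.
    by move: of1; set f := _%:~R; lra.
  by lia.
apply/allpairsP; rewrite /dyadic_index.
by case: (near _ _ _ ar zx) => ->; case: (near _ _ _ br zy) => ->;
  [exists (0, 0)|exists (0, 1)|exists (1, 0)|exists (1, 1)]; rewrite !inE.
Qed.

Lemma meets_nearby n s k : s \in approx_squares (@small_a _ S (2 ^- n)) ->
  meets_square n s k -> k \in nearby n s.
Proof. by move=> sn /asboolP [z [sz /dyadic_squareP ->]]; exact: nearbyP. Qed.

Lemma size_nearby n s : size (nearby n s) = 4%N. Proof. by []. Qed.

End Geometry.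

(** * Self-affine measures *)

Section Plane.
Set Implicit Arguments.
Unset Strict Implicit.
Context {R : realType}.
Implicit Types (A B : set (R * R)).

Lemma measurable_rectangle (i i' : interval R) :
  measurable [set z : R * R | z.1 \in i /\ z.2 \in i'].
Proof.
have -> : [set z : R * R | z.1 \in i /\ z.2 \in i'] = [set` i] `*` [set` i'].
  by apply/seteqP; split=> z [].
by apply: measurableX; exact: measurable_itv.
Qed.

Lemma measurable_dyadic_square n k : measurable (@dyadic_square R n k).
Proof.
have := measurable_rectangle `[k.1%:~R * 2 ^- n, (k.1 + 1)%:~R * 2 ^- n[
  `[k.2%:~R * 2 ^- n, (k.2 + 1)%:~R * 2 ^- n[.
by congr (measurable _); apply/seteqP; split=> z; rewrite /= !in_itv.
Qed.

Lemma open_dyadic_square (U : set (R * R)) z : open U -> U z ->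
  exists n, dyadic_square n (dyadic_index n z) `<=` U.
Proof.
move=> /[swap] Uz /(_ _) oU; have : nbhs z U by exact: open_nbhs_nbhs.
move=> /nbhs_ballP [e /= e0 eU].
have [n ne] : exists n, 2^-1 ^+ n < e by apply: expr_lt_eps => //; lra.
exists n => y yz; apply: eU; have : dyadic_square n (dyadic_index n z) z.
  exact/dyadic_squareP.
move: yz; rewrite /dyadic_square /= !intrD !mulrDl !mul1r => -[y1 y2] [z1 z2].
rewrite exprVn in ne; split; rewrite /ball /= ltr_distl.
  by move: y1 z1; set u := _%:~R * _; lra.
by move: y2 z2; set u := _%:~R * _; lra.
Qed.

Let square_in (U : set (R * R)) (i : nat) : set (R * R) :=
  if unpickle i is Some (n, k) then
    if `[< dyadic_square n k `<=` U >] then dyadic_square n k else set0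
  else set0.

Let open_squares (U : set (R * R)) : open U -> U = \bigcup_i square_in U i.
Proof.
move=> oU; apply/seteqP; split=> [z Uz|z [i _]].
  have [n nU] := open_dyadic_square oU Uz.
  exists (pickle (n, dyadic_index n z)) => //.
  by rewrite /square_in pickleK asboolT//; exact/dyadic_squareP.
by rewrite /square_in; case: unpickle => // -[n k]; case: asboolP => // sU /sU.
Qed.

(** The sigma-algebra on the plane is generated by rectangles, so an open set is written as the
    countable union of the dyadic squares inside it. *)
Lemma measurable_open_plane (U : set (R * R)) : open U -> measurable U.
Proof.
move=> /open_squares ->; apply: bigcup_measurable => i _; rewrite /square_in.
case: unpickle => [[n k]|] //; case: ifP => // _; exact: measurable_dyadic_square.
Qed.

(* A point outside the support lies in a null dyadic square, and there are only
   countably many dyadic squares. *)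
Lemma support_meets (mu : {measure set (R * R)%type -> \bar R}) A :
  measurable A -> (0 < mu A)%E -> A `&` topological_support mu !=set0.
Proof.
move=> mA A0; apply: contrapT => /set0P/negP/negPn/eqP A_supp.
pose N i : set (R * R) := if unpickle i is Some (n, k) then
  if `[< mu (dyadic_square n k) = 0%E >] then dyadic_square n k else set0
  else set0.
have : mu.-negligible A.
  apply: (@negligibleS _ _ _ mu (\bigcup_i N i)) => [z Az|].
    have : ~ topological_support mu z by move=> sz; have : set0 z by rewrite -A_supp.
    move=> /existsNP [U /not_implyP [oU /not_implyP [Uz /negP]]].
    rewrite -leNgt measure_le0 => /eqP U0.
    have [n nU] := open_dyadic_square oU Uz.
    exists (pickle (n, dyadic_index n z)) => //.
    rewrite /N pickleK asboolT; first exact/dyadic_squareP.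
    apply: (subset_measure0 _ _ nU U0); first exact: measurable_dyadic_square.
    exact: measurable_open_plane.
  apply: negligible_bigcup => i; rewrite /N; case: unpickle => [[n k]|]; last first.
    exact: negligible_set0.
  case: asboolP => [n0|_]; last exact: negligible_set0.
  by apply/negligibleP => //; exact: measurable_dyadic_square.
by move=> /(measure_negligible mA) muA0; move: A0; rewrite muA0 ltxx.
Qed.

End Plane.

Section SelfAffine.
Set Implicit Arguments.
Unset Strict Implicit.
Context {R : realType} {S : LG_system R} (p : LG_index S -> R).
Hypothesis hp : positive_probability_vector p.
Context (mu : probability (R * R)%type R).
Hypothesis hmu : self_affine p mu.
Implicit Types (g : LG_index S) (j : 'I_(lg_m S)).
Implicit Types (w : seq (LG_index S)) (v : seq 'I_(lg_m S)).
Implicit Types (s : mixed_word S) (z : R * R) (A B : set (R * R)).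

Local Notation a g := (lg_a (tagged g)).
Local Notation c g := (lg_c (tagged g)).
Local Notation rows w := [seq tag g | g <- w].

Definition mass A : R := fine (mu A).

Lemma massE A : measurable A -> mu A = (mass A)%:E.
Proof. by move=> mA; rewrite /mass fineK// fin_num_measure. Qed.

Lemma mass_ge0 A : 0 <= mass A.
Proof. by rewrite fine_ge0. Qed.

Lemma massT : mass setT = 1.
Proof. by rewrite /mass probability_setT. Qed.

Lemma mass_le A B : measurable A -> measurable B -> A `<=` B -> mass A <= mass B.
Proof. by move=> mA mB AB; rewrite -lee_fin -!massE// le_measure ?inE. Qed.

Lemma massU A B : measurable A -> measurable B ->
  mass (A `|` B) <= mass A + mass B.
Proof.
move=> mA mB; rewrite -lee_fin EFinD -!massE//; last exact: measurableU.
exact: measureU2.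
Qed.

Lemma measurable_affine (r o r' o' : R) A : measurable A ->
  measurable ((fun z : R * R => (r * z.1 + o, r' * z.2 + o')) @^-1` A).
Proof.
move=> mA; rewrite -[X in measurable X]setTI.
have : measurable_fun setT (fun z : R * R => (r * z.1 + o, r' * z.2 + o')).
  by apply: measurable_fun_pair; apply: measurable_funD => //;
    apply: measurable_funM => //.
by apply.
Qed.

Lemma measurable_LG_map g A : measurable A -> measurable (LG_map g @^-1` A).
Proof. exact: measurable_affine. Qed.

Lemma measurable_word_map w A : measurable A -> measurable (word_map w @^-1` A).
Proof. exact: measurable_affine. Qed.

Lemma mass_self_affine A : measurable A ->
  mass A = \sum_g p g * mass (LG_map g @^-1` A).
Proof.
move=> mA; apply: EFin_inj; rewrite -massE// hmu// -sumEFin.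
apply: eq_bigr => g _; rewrite EFinM; congr (_ * _)%E.
exact: (massE (measurable_LG_map g mA)).
Qed.

Let box (t : R) : set (R * R) := [set z | z.1 \in `[- t, 1 + t] /\ z.2 \in `[- t, 1 + t]].

Let measurable_box t : measurable (box t). Proof. exact: measurable_rectangle. Qed.

(** Every map sends the unit square into itself and contracts by a factor at most [l], so it sends
    [box t] into [box (l * t)]; self-affinity then compares the masses. *)
Let box_contract : exists2 l : R, 0 <= l < 1 &
  forall t, 0 <= t -> mass (box t) <= mass (box (l * t)).
Proof.
have [l [l0 l1 bl]] := finite_upper_bound (@lg_b_lt1 _ S).
exists l => [|t t0]; first by rewrite (ltW l0).
rewrite [leRHS]mass_self_affine// -[leLHS]mul1r -hp.2 mulr_suml.
apply: ler_sum => g _; rewrite ler_pM2l ?hp.1//; apply: mass_le => //.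
  exact: measurable_LG_map.
move=> z; rewrite /box /LG_map /= !in_itv /=.
have := lg_ac_le1 g; have := lg_c_ge0 (tagged g); have := lg_a_gt0 (tagged g).
have := lg_bd_le1 (tag g); have := lg_d_gt0 (tag g); have := lg_b_gt0 (tag g).
have := lg_a_lt_b (tagged g); have := bl (tag g).
set b := lg_b _; set d := lg_d _; set a := lg_a _; set c := lg_c _.
move=> *.
have at_ : a * t <= l * t by rewrite ler_wpM2r//; lra.
have bt_ : b * t <= l * t by rewrite ler_wpM2r//; lra.
by split; apply/andP; split; nra.
Qed.

(** Iterating the contraction brings the mass of any large box into [box t], and large boxes exhaust
    the plane. *)
Let mass_box t : 0 < t -> mass (box t) = 1.
Proof.
move=> t0; apply/eqP; rewrite eq_le; apply/andP; split.
  by rewrite -massT; apply: mass_le.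
have [l /andP[l0 l1] bl] := box_contract.
have le_n (n : nat) : mass (box n%:R) <= mass (box t).
  have [k kt] : exists k, l ^+ k < t / n.+1%:R.
    by apply: expr_lt_eps; rewrite ?divr_gt0// l0.
  apply: (@le_trans _ _ (mass (box (l ^+ k * n%:R)))).
    elim: k {kt} => [|k IHk]; first by rewrite expr0 mul1r.
    rewrite (le_trans IHk)// exprS -mulrA; apply: bl.
    by rewrite mulr_ge0// exprn_ge0.
  apply: mass_le => // z; rewrite /box /= !in_itv /=.
  have : l ^+ k * n%:R <= t.
    move: kt; rewrite ltr_pdivlMr// => /ltW; apply: le_trans.
    by rewrite ler_wpM2l ?exprn_ge0// ler_nat.
  by set u := l ^+ k * _; lra.
have := @nondecreasing_cvg_mu _ _ _ mu (fun n => box n%:R).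
have -> : \bigcup_n box n%:R = setT.
  apply/seteqP; split=> // z _; exists (Num.bound (`|z.1| + `|z.2|)) => //.
  have := archi_boundP (addr_ge0 (normr_ge0 z.1) (normr_ge0 z.2)).
  rewrite /box /= !in_itv /=; set N := _%:R.
  have := ler_norm z.1; have := ler_norm (- z.1); have := ler_norm z.2.
  have := ler_norm (- z.2); rewrite !normrN.
  have := normr_ge0 z.1; have := normr_ge0 z.2. lra.
move=> /(_ (fun=> measurable_box _) measurableT) cvg_box.
rewrite -lee_fin -massE// -(probability_setT mu).
apply: cvge_le (cvg_box _) => [|m n mn].
  by apply: nearW => n; rewrite /= !massE// lee_fin.
apply/subsetPset => z; rewrite /box /= !in_itv /= => -[z1 z2].
have : m%:R <= n%:R :> R by rewrite ler_nat.
by move: (m%:R : R) (n%:R : R) z1 z2 => x y z1 z2 xy; split; lra.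
Qed.

(** The closed unit square is the intersection of countably many boxes of mass 1, so its complement
    is a countable union of null sets. *)
Lemma mass_off_unit_square A : measurable A ->
  (forall z, A z -> ~ (0 <= z.1 <= 1 /\ 0 <= z.2 <= 1)) -> mass A = 0.
Proof.
move=> mA A01; rewrite /mass; suff: mu.-negligible A.
  by move=> /(measure_negligible mA) ->.
apply: (@negligibleS _ _ _ mu (\bigcup_(n : nat) ~` box n.+1%:R^-1)) => [z Az|].
  apply: contrapT => nz; apply: (A01 z Az).
  have zbox n : z.1 \in `[- n.+1%:R^-1, 1 + n.+1%:R^-1] /\
      z.2 \in `[- n.+1%:R^-1, 1 + n.+1%:R^-1].
    by apply: contrapT => nb; apply: nz; exists n.
  have close (x : R) : (forall n, x \in `[- n.+1%:R^-1, 1 + n.+1%:R^-1]) -> 0 <= x <= 1.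
    move=> xn; have le0 (e : R) : (forall n, e <= n.+1%:R^-1) -> e <= 0.
      move=> en; rewrite leNgt; apply/negP => /ltr_add_invr [k].
      by rewrite add0r ltNge en.
    apply/andP; split.
      rewrite -oppr_le0; apply: le0 => n; have := xn n; rewrite in_itv /=.
      by move: (_^-1) => y; lra.
    rewrite -subr_le0; apply: le0 => n; have := xn n; rewrite in_itv /=.
    by move: (_^-1) => y; lra.
  by split; apply: close => n; have [] := zbox n.
apply: negligible_bigcup => n; apply/negligibleP; first exact: measurableC.
have := probability_setC mu (measurable_box n.+1%:R^-1).
by rewrite (massE (measurable_box _)) mass_box// subee.
Qed.

End SelfAffine.

(** * Powers of finite sums *)

Lemma sum_le_size_max (R : realDomainType) (I : eqType) (r : seq I)
    (x : I -> R) : (0 < size r)%N ->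
  exists2 i, i \in r & \sum_(j <- r) x j <= (size r)%:R * x i.
Proof.
elim: r => // i [|k r] IHr _.
  by exists i; rewrite ?mem_head// big_seq1 mul1r.
have [m mr xm] := IHr isT; have [im|/ltW mi] := leP (x i) (x m).
  exists m; first by rewrite in_cons mr orbT.
  by rewrite big_cons mulrS mulrDl mul1r lerD.
exists i; first exact: mem_head.
rewrite big_cons mulrS mulrDl mul1r lerD2l.
by rewrite (le_trans xm)// ler_wpM2l.
Qed.

(** Bounding the sum by [M] times its largest term treats all [q >= 0] alike; [r] is non-empty
    because at [q = 0] the power of an empty sum is 1. *)
Lemma powR_sum_le (R : realType) (I : eqType) (r : seq I) (x : I -> R)
    (M : nat) (q : R) : 0 <= q -> (0 < size r <= M)%N ->
  (forall i, 0 <= x i) ->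
  (\sum_(i <- r) x i) `^ q <= M%:R `^ q * \sum_(i <- r) x i `^ q.
Proof.
move=> q0 /andP[r0 rM] x0; have [i ir sumr] := @sum_le_size_max _ _ r x r0.
have sumM : \sum_(j <- r) x j <= M%:R * x i.
  by rewrite (le_trans sumr)// ler_wpM2r ?ler_nat.
apply: (@le_trans _ _ ((M%:R * x i) `^ q)).
  by apply: ge0_ler_powR; rewrite ?nnegrE ?sumr_ge0 ?mulr_ge0.
rewrite powRM// ler_wpM2l ?powR_ge0// (big_rem i ir) /= lerDl.
by apply: sumr_ge0 => j _; rewrite powR_ge0.
Qed.

(** * Mass carried by approximate squares *)

Section CellMass.
Set Implicit Arguments.
Unset Strict Implicit.
Context {R : realType} {S : LG_system R} (p : LG_index S -> R).
Hypothesis hp : positive_probability_vector p.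
Context (mu : probability (R * R)%type R).
Hypothesis hmu : self_affine p mu.
Implicit Types (g : LG_index S) (j : 'I_(lg_m S)).
Implicit Types (w : seq (LG_index S)) (v : seq 'I_(lg_m S)).
Implicit Types (s : mixed_word S) (z : R * R) (A B : set (R * R)).

Local Notation rows w := [seq tag g | g <- w].
Local Notation tag_index i := (Tagged (fun j => 'I_(lg_n j)) i).

(* The part of [mu] carried by the maps whose row word starts with [v]. *)
Fixpoint row_mass v A : R :=
  if v is j :: v' then
    \sum_(i < lg_n j) p (tag_index i) * row_mass v' (LG_map (tag_index i) @^-1` A)
  else mass mu A.

Lemma row_mass_harmonic v A : measurable A ->
  row_mass v A = \sum_j row_mass (rcons v j) A.
Proof.
elim: v A => [|j v IHv] A mA /=; first by rewrite (mass_self_affine hmu)// sum_index.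
rewrite exchange_big /=; apply: eq_bigr => i _.
by rewrite -mulr_sumr -IHv//; exact: measurable_LG_map.
Qed.

Lemma row_mass_ge0 v A : 0 <= row_mass v A.
Proof.
elim: v A => [|j v IHv] A /=; first exact: mass_ge0.
by apply: sumr_ge0 => i _; rewrite mulr_ge0// ltW// hp.1.
Qed.

Lemma row_massT v : row_mass v setT = q_word p v.
Proof.
elim: v => [|j v IHv] /=; first by rewrite massT /q_word big_nil.
rewrite /q_word big_cons /row_prob mulr_suml.
by apply: eq_bigr => i _; rewrite preimage_setT IHv.
Qed.

Lemma row_massU v A B : measurable A -> measurable B ->
  row_mass v (A `|` B) <= row_mass v A + row_mass v B.
Proof.
elim: v A B => [|j v IHv] A B mA mB /=; first exact: massU.
rewrite -big_split; apply: ler_sum => i _ /=.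
rewrite -mulrDr ler_pM2l ?hp.1// preimage_setU.
by apply: IHv; exact: measurable_LG_map.
Qed.

(** The column indices are summed out, so the row word confines the mass only in [y]; in [x] the
    maps just preserve [[0, 1]]. *)
Lemma row_mass_off_strip v A : measurable A ->
  (forall z, A z ->
    ~ (0 <= z.1 <= 1 /\ y_offset v <= z.2 <= y_offset v + b_word v)) ->
  row_mass v A = 0.
Proof.
elim: v A => [|j v IHv] A mA Av /=.
  apply: (mass_off_unit_square hp hmu) => // z /Av.
  by rewrite /= b_word_nil add0r.
rewrite big1// => i _; rewrite IHv ?mulr0//; first exact: measurable_LG_map.
move=> z Az [z1 z2]; apply: (Av _ Az); rewrite /LG_map /=.
have -> : b_word (j :: v) = lg_b j * b_word v by rewrite /b_word big_cons.
have := lg_ac_le1 (tag_index i); have := lg_c_ge0 i; have := lg_a_gt0 i.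
have := lg_b_gt0 j; rewrite /=; move: (lg_b j) (lg_a i) (lg_c i) => b a c.
move=> b0 a0 c0 ca.
split; first by apply/andP; split; nra.
have [h1 h2] := andP z2.
have : b * y_offset v <= b * z.2 <= b * (y_offset v + b_word v).
  by rewrite !ler_pM2l// h1 h2.
by rewrite mulrDr; lra.
Qed.

(** The part of [mu] whose address begins with the maps of [s.1] and goes on with the rows of
    [s.2]. *)
Definition cell_mass s A := p_word p s.1 * row_mass s.2 (word_map s.1 @^-1` A).

(** Two harmonic decompositions in turn: over the words of maps by self-affinity, then over their
    row completions. *)
Lemma mass_sum_cells stop A : measurable A ->
  mass mu A = \sum_(s <- approx_squares stop) cell_mass s A.
Proof.
move=> mA; rewrite sum_approx /cell_mass /=.
pose F w := p_word p w * mass mu (word_map w @^-1` A).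
have FE w : F w = \sum_g F (rcons w g).
  rewrite /F (mass_self_affine hmu); last exact: measurable_word_map.
  rewrite mulr_sumr; apply: eq_bigr => g _.
  rewrite p_word_rcons mulrA; congr (_ * mass mu _).
  by apply/seteqP; split=> z; rewrite /preimage /= word_map_rcons.
transitivity (F [::]).
  rewrite /F /p_word big_nil mul1r; congr (mass mu _).
  by apply/seteqP; split=> -[z1 z2];
    rewrite /preimage /word_map /= /a_word /b_word !big_nil !mul1r !addr0.
rewrite -(sum_cutset stop FE); apply: eq_bigr => w _.
rewrite -mulr_sumr; congr (_ * _).
have mw := measurable_word_map w mA.
by rewrite (sum_cutset _ (fun v => @row_mass_harmonic v _ mw)).
Qed.

Lemma cell_mass_ge0 s A : 0 <= cell_mass s A.
Proof. by rewrite mulr_ge0 ?row_mass_ge0// ltW// p_word_gt0. Qed.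

Lemma cell_massT s : cell_mass s setT = word_mass p s.
Proof. by rewrite /cell_mass preimage_setT row_massT. Qed.

Lemma cell_massU s A B : measurable A -> measurable B ->
  cell_mass s (A `|` B) <= cell_mass s A + cell_mass s B.
Proof.
move=> mA mB; rewrite -mulrDr ler_pM2l ?p_word_gt0// preimage_setU.
by apply: row_massU; exact: measurable_word_map.
Qed.

Lemma cell_mass_off_cell s A : measurable A -> A `&` cell s = set0 ->
  cell_mass s A = 0.
Proof.
move=> mA As; rewrite /cell_mass row_mass_off_strip ?mulr0//.
  exact: measurable_word_map.
move=> z Az [z1 z2]; suff : (A `&` cell s) (word_map s.1 z) by rewrite As.
split=> //; rewrite /cell /word_map /y_word /= y_offset_cat b_word_cat.
have a0 := a_word_gt0 s.1; have b0 := b_word_gt0 (rows s.1).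
split; apply/andP; split; first by nra.
- by nra.
- by rewrite addrC lerD2r ler_pM2l//; case/andP: z2.
- by rewrite addrC -addrA lerD2l -mulrDr ler_pM2l//; case/andP: z2.
Qed.

Lemma cell_mass_le s A B : measurable A -> measurable B -> A `<=` B ->
  cell_mass s A <= cell_mass s B.
Proof.
move=> mA mB AB; rewrite ler_pM2l ?p_word_gt0//.
have := @measurable_word_map _ _ s.1 _ mA.
have := @measurable_word_map _ _ s.1 _ mB.
have : word_map s.1 @^-1` A `<=` word_map s.1 @^-1` B by move=> z /AB.
elim: s.2 (_ @^-1` A) (_ @^-1` B) => [|j v IHv] A' B' AB' mB' mA' /=.
  exact: mass_le.
apply: ler_sum => i _; rewrite ler_pM2l ?hp.1//.
by apply: IHv; [move=> z /AB'|exact: measurable_LG_map..].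
Qed.

Lemma cell_mass_le_mass stop s A : measurable A ->
  s \in approx_squares stop -> cell_mass s A <= mass mu A.
Proof.
move=> mA ss; rewrite (mass_sum_cells stop mA) (big_rem s ss) /= lerDl.
by apply: sumr_ge0 => t _; exact: cell_mass_ge0.
Qed.

Let squares n := approx_squares (@small_a _ S (2 ^- n)).

Lemma mass_dyadic_le n k : mass mu (dyadic_square n k) <=
  \sum_(s <- squares n | meets_square n s k) word_mass p s.
Proof.
have mk := @measurable_dyadic_square R n k.
rewrite (mass_sum_cells (@small_a _ S (2 ^- n)) mk) big_mkcond [leRHS]big_mkcond /=.
apply: ler_sum => s _; case: ifPn => [_|/asboolPn nm].
  by rewrite -cell_massT cell_mass_le.
rewrite cell_mass_off_cell// setIC; apply/eqP/negPn/negP => /set0P; exact: nm.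
Qed.

(** The finitely many closed cells carry the whole mass, so their complement is an open null set and
    contains no point of the support. *)
Lemma support_in_cell n z : topological_support mu z ->
  exists2 s, s \in squares n & cell s z.
Proof.
move=> sz; apply: contrapT => nz.
pose U := \big[setI/setT]_(s <- squares n) ~` cell s.
have oU : open U.
  apply: big_ind => [|A B oA oB|s _]; [exact: openT|exact: openI|].
  apply: closed_openC.
  have -> : cell s = (fst @^-1` `[x_offset s.1, x_offset s.1 + a_word s.1]) `&`
      (snd @^-1` `[y_offset (y_word s), y_offset (y_word s) + b_word (y_word s)]).
    by apply/seteqP; split=> y; rewrite /cell /= !in_itv.
  by apply: closedI; apply: closed_comp; try exact: interval_closed => y;
    move=> *; [exact: cvg_fst|exact: cvg_snd].
have UP (y : R * R) : U y <-> forall s, s \in squares n -> ~ cell s y.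
  rewrite /U; elim: (squares n) => [|s l IHl]; first by rewrite big_nil; split.
  rewrite big_cons; split=> [[sy /IHl ly] t|sy].
    by rewrite inE => /orP[/eqP ->|/ly].
  split; first by apply: sy; rewrite inE eqxx.
  by apply/IHl => t tl; apply: sy; rewrite inE tl orbT.
have Uz : U z by apply/UP => s ss cz; apply: nz; exists s.
have mU := measurable_open_plane oU.
have : (0 < (mass mu U)%:E)%E by rewrite -(massE mu mU); exact: sz.
rewrite (mass_sum_cells (@small_a _ S (2 ^- n)) mU).
rewrite big_seq big1 ?ltxx// => s ss; apply: cell_mass_off_cell => //.
by apply/seteqP; split=> // y [/UP /(_ _ ss)].
Qed.

Lemma cell_mass_bigU s (A : int * int -> set (R * R)) (r : seq (int * int)) :
  (forall k, measurable (A k)) ->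
  cell_mass s (\big[setU/set0]_(k <- r) A k) <= \sum_(k <- r) cell_mass s (A k).
Proof.
move=> mA; elim: r => [|k r IHr].
  by rewrite !big_nil cell_mass_off_cell// set0I.
rewrite !big_cons (le_trans (cell_massU _ _ _))//; last by rewrite lerD2l.
by apply: bigsetU_measurable => i _; exact: mA.
Qed.

(** The cell is covered by the four squares [nearby], so one of them receives at least a quarter of
    its mass. *)
Lemma word_mass_le n s : s \in squares n ->
  exists k, meets_square n s k /\ word_mass p s <= 4 * mass mu (dyadic_square n k).
Proof.
move=> ss; have mk := @measurable_dyadic_square R n.
pose U := \big[setU/set0]_(k <- nearby n s) @dyadic_square R n k.
have mU : measurable U by apply: bigsetU_measurable => k _; exact: mk.
have cover : word_mass p s <= \sum_(k <- nearby n s) cell_mass s (dyadic_square n k).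
  apply: le_trans (cell_mass_bigU _ _ mk); rewrite -/U -cell_massT.
  rewrite -(setUv U) (le_trans (cell_massU _ mU (measurableC mU)))//.
  rewrite (@cell_mass_off_cell s (~` U)) ?addr0//; first exact: measurableC.
  apply/seteqP; split=> // z [nU sz]; apply: nU.
  have := nearbyP ss sz; rewrite /U; set k := dyadic_index n z => kn.
  by rewrite (big_rem k kn) /=; left; apply/dyadic_squareP.
have [k kn sum_k] :=
  @sum_le_size_max _ _ (nearby n s) (fun k => cell_mass s (dyadic_square n k)) isT.
exists k; split; last first.
  by rewrite (le_trans cover)// (le_trans sum_k)// ler_wpM2l// (cell_mass_le_mass _ ss).
(* A square disjoint from the cell receives none of its mass, whereas [word_mass] is positive. *)
apply/asboolP; apply: contrapT => /set0P/negP/negPn/eqP sk.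
have := word_mass_gt0 hp s; rewrite ltNge (le_trans cover)// (le_trans sum_k)//.
by rewrite cell_mass_off_cell ?mulr0// setIC.
Qed.

End CellMass.

(** * Dyadic sums *)

Section DyadicSum.
Set Implicit Arguments.
Unset Strict Implicit.
Context {R : realType} {S : LG_system R} (p : LG_index S -> R).
Hypothesis hp : positive_probability_vector p.
Context (mu : probability (R * R)%type R).
Hypothesis hmu : self_affine p mu.
Context (q : R).
Hypothesis hq : 0 <= q.

Let squares n := approx_squares (@small_a _ S (2 ^- n)).
Let flat n : set (int * int) :=
  [set k | dyadic_square n k `&` topological_support mu !=set0].
(** A finite duplicate-free list of indices to sum over: a point of the support lies in some cell,
    so its square is near that cell. *)
Let flat_seq n : seq (int * int) :=
  [seq k <- undup (flatten [seq nearby n s | s <- squares n]) | `[< flat n k >]].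

Let flat_seqP n k : flat n k <-> k \in flat_seq n.
Proof.
rewrite mem_filter mem_undup; split=> [fk|/andP[/asboolP//]].
apply/andP; split; first exact/asboolP.
have [z [/dyadic_squareP -> sz]] := fk.
have [s ss cz] := support_in_cell hp hmu n sz.
by apply/flattenP; exists (nearby n s); [exact: map_f|exact: nearbyP].
Qed.

Let flat_seq_uniq n : uniq (flat_seq n).
Proof. by rewrite filter_uniq// undup_uniq. Qed.

Definition dyadic_sum n : R :=
  \sum_(k <- flat_seq n) mass mu (dyadic_square n k) `^ q.

Lemma esum_dyadic_flat n :
  (\esum_(C in dyadic_flat mu n) poweR (mu C) q)%E = (dyadic_sum n)%:E.
Proof.
have -> : dyadic_flat mu n = @dyadic_square R n @` [set` flat_seq n].
  apply/seteqP; split=> [C [[k _ <-] kC]|_ [k /flat_seqP fk <-]].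
    by exists k => //; exact/flat_seqP.
  by split=> //; exists k.
rewrite esum_image; last by move=> k k' _ _; exact: dyadic_square_inj.
rewrite esum_fset; [|exact: finite_seq|by move=> k _; exact: poweR_ge0].
rewrite -fsbig_seq// /dyadic_sum -sumEFin; apply: eq_bigr => k _.
by rewrite (massE mu (@measurable_dyadic_square R n k)) poweR_EFin.
Qed.

Lemma dyadic_sum_bounds : exists2 K : R, 0 < K & forall n,
  K^-1 * \sum_(s <- squares n) word_mass p s `^ q <= dyadic_sum n <=
  K * \sum_(s <- squares n) word_mass p s `^ q.
Proof.
have [M countM] := @count_meets R S.
pose N : R := M.+1%:R; have N1 : 1 <= N by rewrite ler1n.
have N0 : 0 < N by lra.
(* In [K1] the first factor comes from at most [N] cells per square and 4 counts the squares per
   cell; in [K2] the first comes from the square with a quarter of the mass and [N] again counts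
   cells per square. *)
pose K1 := N `^ q * 4; pose K2 := 4 `^ q * N.
have K10 : 0 < K1 by rewrite mulr_gt0 ?powR_gt0.
have K20 : 0 < K2 by rewrite mulr_gt0 ?powR_gt0.
have upper n : dyadic_sum n <= K1 * \sum_(s <- squares n) word_mass p s `^ q.
  apply: (@le_trans _ _ (\sum_(k <- flat_seq n)
      \sum_(s <- squares n | meets_square n s k) N `^ q * word_mass p s `^ q)).
    rewrite /dyadic_sum !big_seq; apply: ler_sum => k /flat_seqP fk.
    apply: (@le_trans _ _ ((\sum_(s <- squares n | meets_square n s k)
        word_mass p s) `^ q)).
      apply: ge0_ler_powR; rewrite ?nnegrE ?mass_ge0//.
        by apply: sumr_ge0 => s _; rewrite ltW ?word_mass_gt0.
      exact: mass_dyadic_le.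
    rewrite -mulr_sumr -!(big_filter (squares n)); apply: powR_sum_le => //.
      rewrite size_filter (leq_trans (countM n k))// andbT -has_count.
      have [z [kz sz]] := fk; have [s ss cz] := support_in_cell hp hmu n sz.
      by apply/hasP; exists s => //; apply/asboolP; exists z.
    by move=> s; rewrite ltW ?word_mass_gt0.
  under eq_bigr do rewrite big_mkcond; rewrite exchange_big /=.
  rewrite mulr_sumr !big_seq; apply: ler_sum => s ss.
  rewrite -big_mkcond -big_filter big_const_seq count_predT iter_addr_0.
  rewrite -[leLHS]mulr_natl mulrA /K1 [_ * 4]mulrC.
  rewrite !ler_wpM2r ?powR_ge0// ler_nat.
  rewrite -(size_nearby n s); apply: uniq_leq_size; first by rewrite filter_uniq.
  by move=> k; rewrite mem_filter => /andP[mk _]; exact: meets_nearby.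
have lower n : \sum_(s <- squares n) word_mass p s `^ q <= K2 * dyadic_sum n.
  apply: (@le_trans _ _ (\sum_(s <- squares n) \sum_(k <- flat_seq n |
      meets_square n s k) 4 `^ q * mass mu (dyadic_square n k) `^ q)).
    rewrite !big_seq; apply: ler_sum => s ss.
    have [k [sk km]] := word_mass_le hp hmu ss.
    (* Positive mass forces the square to meet the support, so it occurs in the dyadic sum. *)
    have m0 : 0 < mass mu (dyadic_square n k).
      by have := word_mass_gt0 hp s; lra.
    have kf : k \in flat_seq n.
      apply/flat_seqP; apply: support_meets; first exact: measurable_dyadic_square.
      by have := m0; rewrite -lte_fin -(massE mu (@measurable_dyadic_square R n k)).
    rewrite (big_rem k kf) /= sk -[leLHS]addr0 lerD//.
      rewrite -powRM ?(ltW m0)//; apply: ge0_ler_powR; rewrite ?nnegrE//.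
        by rewrite ltW ?word_mass_gt0.
      by rewrite mulr_ge0// ltW.
    by apply: sumr_ge0 => i _; rewrite mulr_ge0 ?powR_ge0.
  under eq_bigr do rewrite big_mkcond; rewrite exchange_big /=.
  rewrite /dyadic_sum mulr_sumr; apply: ler_sum => k _.
  rewrite -big_mkcond -big_filter big_const_seq count_predT iter_addr_0.
  rewrite -[leLHS]mulr_natl mulrA ler_wpM2r ?powR_ge0// [_ * 4 `^ q]mulrC.
  rewrite ler_wpM2l ?powR_ge0// ler_nat size_filter.
  by rewrite (leq_trans (countM n k)).
exists (K1 + K2) => [|n]; first by rewrite addr_gt0.
have s0 : 0 <= \sum_(s <- squares n) word_mass p s `^ q.
  by apply: sumr_ge0 => s _; rewrite powR_ge0.
have d0 : 0 <= dyadic_sum n by apply: sumr_ge0 => k _; rewrite powR_ge0.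
apply/andP; split.
  rewrite ler_pdivrMl ?addr_gt0// (le_trans (lower n))// ler_wpM2r//; lra.
by rewrite (le_trans (upper n))// ler_wpM2r//; lra.
Qed.

(** Both comparisons at [r = 2 ^- n] give a dyadic sum of order 2 to the power [t * n], whose
    logarithmic rate is [t * ln 2]. *)
Lemma Lq_spectrum_growth beta t :
  \sum_j row_prob p j `^ q * lg_b j `^ beta = 1 -> growth p q beta t = 1 ->
  is_Lq_spectrum mu q t.
Proof.
move=> betaE tE; have [K K0 bK] := dyadic_sum_bounds.
have [L L0 bL] := sum_approx_small hp betaE tE.
have KL0 : 0 < K * L by rewrite mulr_gt0.
have x0 : 0 < 2 `^ t :> R by rewrite powR_gt0.
have rE n : (2 ^- n) `^ (- t) = (2 `^ t) ^+ n :> R.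
  rewrite -powR_invn// -powRrM -powR_mulrn ?powR_ge0// -powRrM.
  by congr (_ `^ _); ring.
have bnd n : (K * L)^-1 * (2 `^ t) ^+ n <= dyadic_sum n <= K * L * (2 `^ t) ^+ n.
  have r01 : 0 < (2 ^- n : R) <= 1.
    by rewrite invr_gt0 exprn_gt0// invf_le1 ?exprn_gt0// exprn_ege1// ler1n.
  have := bL _ r01; rewrite rE => /andP[l r].
  have /andP[l' r'] := bK n; apply/andP; split.
    by rewrite (le_trans _ l')// invfM -mulrA ler_pM2l ?invr_gt0.
  by rewrite (le_trans r')// -mulrA ler_pM2l.
have d0 n : 0 < dyadic_sum n.
  have /andP[+ _] := bnd n; apply: lt_le_trans.
  by rewrite mulr_gt0 ?invr_gt0 ?exprn_gt0.
have ln2 : 0 < ln 2 :> R by rewrite ln_gt0// ltr1n.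
have := @cvg_log_rate R dyadic_sum _ _ KL0 x0 bnd; rewrite ln_powR => cvg_d.
rewrite /is_Lq_spectrum.
under eq_cvg do rewrite esum_dyadic_flat lne_EFin// -EFinM.
apply: cvg_EFin; first by apply: nearW.
rewrite -[X in _ --> X](mulfK (lt0r_neq0 ln2)) /comp /=.
under eq_cvg do rewrite invfM mulrA [ln _ * _]mulrC.
exact: cvgMl.
Qed.

End DyadicSum.

Theorem proposition1p4 (R : realType) (S : LG_system R)
  (p : LG_index S -> R) (hp : positive_probability_vector p)
  (mu : probability (R * R)%type R) (hmu : self_affine p mu)
  (q : R) (hq : 0 <= q) :
  exists T : R, is_Lq_spectrum mu q T /\ unique (Psi_equation p q) T.
Proof.
have [beta betaE] := row_exponent hp q.
have [t tE] := growth_unit hp q beta.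
exists t; split; first exact: (Lq_spectrum_growth hp hmu hq betaE tE).
split; first exact/(Psi_equation_unique hp betaE).
(* A second solution would also have [growth] equal to 1, which strict monotonicity excludes. *)
move=> u /(Psi_equation_unique hp betaE) uE.
by case: (ltgtP t u) => // /(growth_decreasing hp q beta); rewrite tE uE ltxx.
Qed.
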